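(* Let $L^2 \subset \mathbb{R}^4$ be a smooth oriented surface, let $\Lambda^2_-(\mathbb{R}^4)|_L = E \oplus F$ be the splitting into the real line bundle $E$ spanned by $\omega^1$ and its orthogonal complement $F$ of rank $2$, and let $\eta$ be a smooth section of $E$ over $L$. Let $$X_\eta = \{(x, \eta_x + \sigma) \in \Lambda^2_-(\mathbb{R}^4)|_L : x \in L,\ \sigma \in F_x\}.$$ Then $X_\eta$ is a coassociative submanifold of $\mathbb{R}^7 \cong \Lambda^2_-(\mathbb{R}^4)$ if and only if $L$ is negative superminimal in $\mathbb{R}^4$ and $\eta$ is a parallel section of $E$, with respect to the connection $\nabla^E$ on $E$ induced from the Levi-Civita connection $\nabla$ on $\mathbb{R}^4$.
   Context: $\Lambda^2_-(\mathbb{R}^4)$ denotes the total space of the bundle of anti-self-dual $2$-forms on Euclidean oriented $\mathbb{R}^4$. For a local oriented orthonormal coframe $e^1,e^2,e^3,e^4$ of $\mathbb{R}^4$, the fibres are spanned by $$\omega^1 = e^1\wedge e^2 - e^3\wedge e^4,\quad \omega^2 = e^1\wedge e^3 - e^4\wedge e^2,\quad \omega^3 = e^1\wedge e^4 - e^2\wedge e^3.$$ The metric on the total space $\Lambda^2_-(\mathbb{R}^4)\cong\mathbb{R}^7$ is the one for which $\bar e_i = (e_i,0)$ ($i=1,\dots,4$) and $\check\omega^i = (0,\omega^i)$ ($i=1,2,3$) form an orthonormal frame. With $\bar e^k$ dual to $\bar e_k$ and $\check\omega_k$ dual to $\check\omega^k$, the canonical torsion-free $\mathrm{G}_2$-structure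 is $$\varphi = \check\omega_1\wedge\check\omega_2\wedge\check\omega_3 + \check\omega_1\wedge(\bar e^1\wedge\bar e^2 - \bar e^3\wedge\bar e^4) + \check\omega_2\wedge(\bar e^1\wedge\bar e^3 - \bar e^4\wedge\bar e^2) + \check\omega_3\wedge(\bar e^1\wedge\bar e^4 - \bar e^2\wedge\bar e^3).$$ A $4$-dimensional submanifold $X$ is coassociative if $\varphi|_X = 0$. Along $L$, the coframe is adapted: $\{e^1,e^2\}$ is an oriented orthonormal coframe of $L$ and $\{e^3,e^4\}=\{\nu^1,\nu^2\}$ an orthonormal frame of the conormal bundle, with $(e^1,e^2,\nu^1,\nu^2)$ oriented. Then $\omega^1 = \mathrm{vol}_L - *_{\mathbb{R}^4}\mathrm{vol}_L$ is a globally defined nowhere vanishing section of $\Lambda^2_-(\mathbb{R}^4)|_L$; $E$ is the real line bundle it spans, and $F = E^\perp$ is locally spanned by $\omega^2,\omega^3$. The connection on $E$ is $\nabla^E = \pi_E\circ\nabla$, with $\pi_E$ the orthogonal projection of $\Lambda^2_-(\mathbb{R}^4)|_L$ onto $E$. For a normal vector field $\nu$, $A^\nu(w) = (\nabla_w\nu)^T$ (tangential part) and $A^\nu_{ij} = \langle A^\nu(e_i),e_j\rangle$, where $\{e_1,e_2\}$ and $\{\nu_1,\nu_2\}$ are the dual adapted tangent and normal frames. For a normal vector $\nu = t_2\nu_1+t_3\nu_2$ write $\nu^\perp = -t_3\nu_1+t_2\nu_2$. $L$ is negative superminimal in $\mathbb{R}^4$ if, at every point and for every normal vector $\nu$, $$A^\nu_{12}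 - A^{\nu^\perp}_{11} = 0,\qquad A^\nu_{22} - A^{\nu^\perp}_{12}=0.$$ *)

(* Defs.v *)
From HB Require Import structures.
From mathcomp Require Import all_boot all_order all_algebra.
From mathcomp Require Import all_classical all_reals all_analysis.

Set Implicit Arguments.
Unset Strict Implicit.
Unset Printing Implicit Defensive.

Import Order.TTheory GRing.Theory Num.Theory.
Import numFieldNormedType.Exports.

Local Open Scope classical_set_scope.
Local Open Scope ring_scope.

(* ** Smooth maps *)

Fixpoint diff_upto (R : realType) (V W : normedModType R) (k : nat)
    (U : set V) (f : V -> W) : Prop :=
  if k is j.+1 then
    (forall x, U x -> differentiable f x) /\
    (forall v : V, diff_upto j U (fun x => 'D_v f x))
  else True.

(* C^oo on the open set U.  Only used with V finite-dimensional, where infinite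
   Frechet differentiability is the same as continuity of all partial
   derivatives of all orders. *)
Definition smooth_on (R : realType) (V W : normedModType R)
    (U : set V) (f : V -> W) : Prop :=
  forall k, diff_upto k U f.

(* Smoothness of a map given on an arbitrary subset M: local existence of smooth
   extensions.  The values of f outside M are irrelevant. *)
Definition smooth_along (R : realType) (V W : normedModType R)
    (M : set V) (f : V -> W) : Prop :=
  forall p, M p -> exists U : set V, exists F : V -> W,
    [/\ open U, U p, smooth_on U F & forall x, U x -> M x -> F x = f x].

(* ** Embedded submanifolds and their tangent spaces *)

(* (U, f) is a local parametrisation of M: an injective immersion of the open
   set U that is a homeomorphism onto a relatively open subset of M (the last
   clause says that f is an open map from U to M). *)
Definition local_param (R : realType) (D V : normedModType R) (M : set V)
    (U : set D) (f : D -> V) : Prop :=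
  [/\ open U,
      smooth_on U f,
      (forall u v, U u -> U v -> f u = f v -> u = v),
      (forall u, U u -> injective ('d f u)) &
      (forall U' : set D, open U' -> U' `<=` U ->
         exists2 O : set V, open O & f @` U' = M `&` O)].

(* Smooth embedded submanifold of V of dimension dim D. *)
Definition submanifold (R : realType) (D V : normedModType R)
    (M : set V) : Prop :=
  forall p, M p -> exists U : set D, exists f : D -> V,
    local_param M U f /\ (f @` U) p.

Definition curve_in (R : realType) (V : normedModType R) (M : set V)
    (p v : V) (c : R^o -> V) : Prop :=
  (exists I : set R^o,
     [/\ open I, I 0, smooth_on I c & forall t, I t -> M (c t)]) /\
  c 0 = p /\ derive1 c 0 = v.

Definition tangent (R : realType) (V : normedModType R) (M : set V) (p : V) :
    set V :=
  [set v | exists c, curve_in M p v c].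

(* Derivative at p, in the direction of w tangent to M at p, of a map f given
   along M with values in a fixed vector space: the derivative of f along any
   curve in M with velocity w.  As the bundles R^4 x R^4 and Lambda^2_-(R^4)
   (below) are trivialised by parallel frames, this is the Levi-Civita
   derivative nabla_w f. *)
Definition nabla (R : realType) (V W : normedModType R) (M : set V)
    (f : V -> W) (p w : V) : W :=
  xget 0 [set d | exists2 c, curve_in M p w c & d = derive1 (f \o c) 0].

(* ** Oriented surfaces in R^4 *)

(* The orientation is a consistently oriented atlas of local parametrisations;
   the matrix in os_compat is the Jacobian of the transition map (row vectors
   acted on from the right). *)
Record oriented_surface (R : realType) := OrientedSurface {
  os_set :> set 'rV[R]_4 ;
  os_charts : set 'rV[R]_2 -> ('rV[R]_2 -> 'rV[R]_4) -> Prop ;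
  os_param : forall U f, os_charts U f -> local_param os_set U f ;
  os_cover : forall p, os_set p ->
    exists U f, os_charts U f /\ (f @` U) p ;
  os_compat : forall U f V g, os_charts U f -> os_charts V g ->
    forall u v, U u -> V v -> f u = g v ->
    exists2 J : 'M[R]_2, 0 < \det J & forall a, 'd f u a = 'd g v (a *m J) }.

(* (a, b) is a positively oriented basis of T_p L. *)
Definition oriented_basis (R : realType) (L : oriented_surface R)
    (p a b : 'rV[R]_4) : Prop :=
  exists U f u, [/\ os_charts L U f, U u, f u = p &
    exists J : 'M[R]_2,
      [/\ 0 < \det J, a = 'd f u (row 0 J) & b = 'd f u (row 1 J)]].

(* ** Linear algebra *)

Definition dot (R : realType) (n : nat) (u v : 'rV[R]_n) : R :=
  (u *m v^T) 0 0.

Definition orthproj (R : realType) (n : nat) (S : set 'rV[R]_n)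
    (v : 'rV[R]_n) : 'rV[R]_n :=
  xget 0 [set u | S u /\ forall w, S w -> dot (v - u) w = 0].

Definition wedge (R : realType) (T : Type) (a b : T -> R) : T -> T -> R :=
  fun u v => a u * b v - a v * b u.

(* Wedge product of a 1-form with a 2-form. *)
Definition wedge12 (R : realType) (T : Type) (a : T -> R) (B : T -> T -> R) :
    T -> T -> T -> R :=
  fun u v w => a u * B v w + a v * B w u + a w * B u v.

(* The forms omega^1, omega^2, omega^3 built from a coframe e^1, ..., e^4;
   indices are shifted to start from 0. *)
Definition omega (R : realType) (T : Type) (e : 'I_4 -> T -> R) (i : 'I_3) :
    T -> T -> R :=
  fun u v => match val i with
  | 0%N => wedge (e 0) (e 1) u v - wedge (e 2) (e 3) u v
  | 1%N => wedge (e 0) (e 2) u v - wedge (e 3) (e 1) u v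
  | _   => wedge (e 0) (e 3) u v - wedge (e 1) (e 2) u v
  end.

(* ** The bundle Lambda^2_-(R^4) and its G2-structure *)

(* A fibre of Lambda^2_-(R^4) is 'rV_3, by coordinates in the orthonormal basis
   omega^i attached to the standard coframe dx^i of R^4; its metric is dot, and
   asd_form c is the 2-form with coordinates c. *)
Definition std_coframe (R : realType) (i : 'I_4) (x : 'rV[R]_4) : R := x 0 i.

Definition asd_form (R : realType) (c : 'rV[R]_3) :
    'rV[R]_4 -> 'rV[R]_4 -> R :=
  fun u v => \sum_(i < 3) c 0 i * omega (@std_coframe R) i u v.

(* R^7 = R^4 x R^3, the total space of Lambda^2_-(R^4). *)
Definition total (R : realType) : normedModType R :=
  ('rV[R]_4 * 'rV[R]_3)%type.

Definition ebar (R : realType) (i : 'I_4) (z : total R) : R := z.1 0 i.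

Definition omcheck (R : realType) (i : 'I_3) (z : total R) : R := z.2 0 i.

Definition phi (R : realType) (u v w : total R) : R :=
  wedge12 (@omcheck R 0) (wedge (@omcheck R 1) (@omcheck R 2)) u v w
  + \sum_(i < 3) wedge12 (@omcheck R i) (omega (@ebar R) i) u v w.

Definition coassociative (R : realType) (X : set (total R)) : Prop :=
  submanifold 'rV[R]_4 X /\
  forall p, X p -> forall u v w,
    tangent X p u -> tangent X p v -> tangent X p w -> phi u v w = 0.

(* ** Geometry along L *)

(* The rows of e are e_1, e_2, nu_1, nu_2: an oriented orthonormal frame of R^4
   whose first two members form an oriented basis of T_p L. *)
Definition adapted (R : realType) (L : oriented_surface R) (p : 'rV[R]_4)
    (e : 'M[R]_4) : Prop :=
  [/\ e *m e^T = 1%:M, \det e = 1 & oriented_basis L p (row 0 e) (row 1 e)].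

Definition coframe (R : realType) (e : 'M[R]_4) (i : 'I_4) (x : 'rV[R]_4) : R :=
  dot (row i e) x.

(* E_p, the line spanned by omega^1 of an adapted coframe at p (which does not
   depend on the coframe). *)
Definition Eline (R : realType) (L : oriented_surface R) (p : 'rV[R]_4) :
    set 'rV[R]_3 :=
  [set c | exists e, adapted L p e /\ exists a : R,
     forall u v, asd_form c u v = a * omega (coframe e) 0 u v].

Definition Fplane (R : realType) (L : oriented_surface R) (p : 'rV[R]_4) :
    set 'rV[R]_3 :=
  [set s | forall c, Eline L p c -> dot s c = 0].

Definition smooth_section_E (R : realType) (L : oriented_surface R)
    (eta : 'rV[R]_4 -> 'rV[R]_3) : Prop :=
  smooth_along L eta /\ forall x, os_set L x -> Eline L x (eta x).

Definition nablaE (R : realType) (L : oriented_surface R)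
    (eta : 'rV[R]_4 -> 'rV[R]_3) (p w : 'rV[R]_4) : 'rV[R]_3 :=
  orthproj (Eline L p) (nabla L eta p w).

Definition parallelE (R : realType) (L : oriented_surface R)
    (eta : 'rV[R]_4 -> 'rV[R]_3) : Prop :=
  forall p w, os_set L p -> tangent L p w -> nablaE L eta p w = 0.

Definition normal_field (R : realType) (L : oriented_surface R)
    (nu : 'rV[R]_4 -> 'rV[R]_4) : Prop :=
  smooth_along L nu /\
  forall x w, os_set L x -> tangent L x w -> dot (nu x) w = 0.

Definition shape (R : realType) (L : oriented_surface R)
    (nu : 'rV[R]_4 -> 'rV[R]_4) (p w : 'rV[R]_4) : 'rV[R]_4 :=
  orthproj (tangent L p) (nabla L nu p w).

Definition shape_coef (R : realType) (L : oriented_surface R)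
    (nu : 'rV[R]_4 -> 'rV[R]_4) (p : 'rV[R]_4) (e : 'M[R]_4) (i j : 'I_4) : R :=
  dot (shape L nu p (row i e)) (row j e).

(* A^nu at p depends only on the normal vector nu(p), so the condition on normal
   vectors is stated for all normal fields nu, nup extending the vectors
   t2 nu_1 + t3 nu_2 and (t2 nu_1 + t3 nu_2)^perp; every normal vector at a
   point of L is the value of such a field. *)
Definition negative_superminimal (R : realType) (L : oriented_surface R) :
    Prop :=
  forall (p : 'rV[R]_4) (e : 'M[R]_4), os_set L p -> adapted L p e ->
  forall (t2 t3 : R) (nu nup : 'rV[R]_4 -> 'rV[R]_4),
    normal_field L nu -> normal_field L nup ->
    nu p = t2 *: row 2 e + t3 *: row 3 e ->
    nup p = - t3 *: row 2 e + t2 *: row 3 e ->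
    shape_coef L nu p e 0 1 - shape_coef L nup p e 0 0 = 0 /\
    shape_coef L nu p e 1 1 - shape_coef L nup p e 0 1 = 0.

Definition Xeta (R : realType) (L : oriented_surface R)
    (eta : 'rV[R]_4 -> 'rV[R]_3) : set (total R) :=
  [set z | os_set L z.1 /\ exists2 s, Fplane L z.1 s & z.2 = eta z.1 + s].

(* Main.v *)
(** For tangent vectors [a], [b] of R^4 read as quaternions, the imaginary part
    of [conj a * b] gives the coordinates of the anti-self-dual part of the
    bivector [a /\ b] (up to a factor 2).  In a chart [f] of L, the vector
    [w = asd (d_0 f) (d_1 f)] therefore spans E, and F is the set of all
    [cross w b].  Differentiating [(f, eta + cross w b)] shows that the tangent
    vectors of X_eta are [(d_a f, d_a eta + cross (d_a w) b + cross w c)], and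
    evaluating phi on one of them and two vertical ones shows that X_eta is
    coassociative iff [d_a eta + cross (d_a w) b] is orthogonal to [w] for all
    [a] and [b].  For [b = 0] this says that eta is parallel; the rest says that
    [d_a w] is proportional to [w].  Since the shape operator of a normal field
    [nu] is [- nu . d_a d_b f], expanding [d_a w] in an adapted frame turns the
    latter into the equations of negative superminimality, by the symmetry of
    second derivatives.  That every normal vector extends to a smooth normal
    field rests on smooth local retractions onto L, obtained from the inverse
    function theorem. *)

Require Import Defs.
From HB Require Import structures.
From mathcomp Require Import all_boot all_order all_algebra.
From mathcomp Require Import all_classical all_reals all_analysis.
From mathcomp Require Import ring lra.
Import Order.TTheory GRing.Theory Num.Theory.
Import numFieldNormedType.Exports.
Local Open Scope classical_set_scope.
Local Open Scope ring_scope.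

Set Implicit Arguments.
Unset Strict Implicit.
Unset Printing Implicit Defensive.

(** * Smooth maps *)

Section SmoothCalculus.
Context {R : realType}.
Implicit Types V W : normedModType R.

(** [F] has no preferred frame and [w] no preferred length. Writing the elements of [F] as
    [cross w b], with [b] in all of R^3, avoids frames at the price of a non-unique [b]; a true
    parametrisation of the fibre, with [b] confined to a plane, serves only to show that [X_eta] is
    a submanifold. The resulting conditions are unchanged when [w] is rescaled, so [w] is never
    normalised.

    Tangent spaces are defined by curves, which makes the two implications asymmetric.
    Coassociativity is tested on explicit curves in [X_eta]; the converse has to control the
    velocity of an arbitrary curve. It does so without lifting the curve to some [b(t)], by
    differentiating the orthogonality of its fibre part to [w]. Vertical parts of tangent vectors
    then lie in the plane orthogonal to [w], while [asd] of two horizontal parts is a multiple of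
    [w], so every term of [phi] vanishes.

    The condition for all [b] says that [d_a w] is proportional to [w] because the triple product of
    [d_a w], [b] and [w] is the scalar product of [b] with [cross w (d_a w)]. *)

Lemma is_diff_eps V W (f : V -> W) (x : V) (df : {linear V -> W}) :
  continuous df ->
  (forall e : R, 0 < e ->
     \forall h \near (0 : V), `|f (h + x) - f x - df h| <= e * `|h|) ->
  is_diff x f df.
Proof.
move=> dfc H.
have fE : f \o shift x = cst (f x) + df +o_ 0 id.
  apply/eqaddoP => e e0.
  have := H _ e0; apply: filterS => h /=.
  by rewrite opprD addrA.
have dE := diff_unique dfc fE.
apply: DiffDef => //; apply/diff_locallyP; rewrite dE; split=> //.
Qed.

Lemma near_eq_differentiable V W (f g : V -> W) (x : V) :
  (\near x, f x = g x) -> differentiable f x -> differentiable g x.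
Proof.
move=> fg df.
suff : is_diff x g ('d f x) by case.
apply: is_diff_eps => [|e e0]; first exact: diff_continuous.
have /eqaddoP/(_ e e0) := diff_locally df.
have : \forall h \near (0 : V), f (h + x) = g (h + x).
  by move: fg; rewrite (near_shift 0); apply: filterS => h; rewrite /= subr0.
apply: filterS2 => h fgh /=.
by rewrite -fgh -(nbhs_singleton fg) opprD addrA.
Qed.

Lemma near_in V (U : set V) x : open U -> U x -> \forall y \near x, U y.
Proof. by move=> oU Ux; exact: open_nbhs_nbhs. Qed.

Lemma near_eq_on V (W : Type) (U : set V) (f g : V -> W) x :
  open U -> U x -> (forall y, U y -> f y = g y) -> \near x, f x = g x.
Proof. by move=> oU Ux fg; apply: filterS (near_in oU Ux). Qed.

Lemma eq_derive_on V W (U : set V) (f g : V -> W) x v :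
  open U -> U x -> (forall y, U y -> f y = g y) -> 'D_v f x = 'D_v g x.
Proof. by move=> oU Ux fg; apply: near_eq_derive; exact: near_eq_on fg. Qed.

Lemma eq_diff_upto V W k (U : set V) (f g : V -> W) :
  open U -> (forall x, U x -> f x = g x) -> diff_upto k U f -> diff_upto k U g.
Proof.
move=> oU; elim: k f g => //= k IH f g fg [df Df]; split=> [x Ux|v].
  apply: near_eq_differentiable (df x Ux).
  exact: near_eq_on fg.
apply: IH (Df v) => x Ux; exact: eq_derive_on fg.
Qed.

Lemma sub_diff_upto V W k (U U' : set V) (f : V -> W) :
  U' `<=` U -> diff_upto k U f -> diff_upto k U' f.
Proof.
move=> UU'; elim: k f => //= k IH f [df Df]; split=> [x /UU'/df//|v].
exact: IH.
Qed.

Lemma diff_uptoW V W k (U : set V) (f : V -> W) :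
  diff_upto k.+1 U f -> diff_upto k U f.
Proof.
elim: k f => // k IH f [df Df]; split=> // v; apply: IH; exact: Df.
Qed.

Lemma diff_upto_cst V W k (U : set V) (a : W) : diff_upto k U (cst a).
Proof.
elim: k a => //= k IH a; split=> [x _|v]; first exact: differentiable_cst.
by rewrite (_ : (fun x => _) = cst 0) //; apply/funext => x; exact: derive_cst.
Qed.

Lemma diff_upto_linear V W k (U : set V) (f : {linear V -> W}) :
  continuous f -> diff_upto k U f.
Proof.
move=> fc; case: k => //= k; split=> [x _|v].
  exact: linear_differentiable.
rewrite (_ : (fun x => _) = cst (f v)); first exact: diff_upto_cst.
by apply/funext => x; rewrite deriveE ?diff_lin //; exact: linear_differentiable.
Qed.

Lemma diff_uptoD V W k (U : set V) (f g : V -> W) : open U ->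
  diff_upto k U f -> diff_upto k U g -> diff_upto k U (fun x => f x + g x).
Proof.
move=> oU; elim: k f g => //= k IH f g [df Df] [dg Dg]; split=> [x Ux|v].
  by apply: differentiableD; [exact: df|exact: dg].
apply: eq_diff_upto (IH _ _ (Df v) (Dg v)) => // x Ux.
by rewrite deriveD //; apply: diff_derivable; [exact: df|exact: dg].
Qed.

Lemma diff_upto_sum V W k (U : set V) n (f : 'I_n -> V -> W) : open U ->
  (forall i, diff_upto k U (f i)) -> diff_upto k U (fun x => \sum_i f i x).
Proof.
move=> oU; elim: n f => [|n IH] f df.
  rewrite (_ : (fun x => _) = cst 0); first exact: diff_upto_cst.
  by apply/funext => x; rewrite big_ord0.
rewrite (_ : (fun x => _) = fun x => f ord0 x + \sum_i f (lift ord0 i) x).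
  apply: diff_uptoD => //; exact: IH.
by apply/funext => x; rewrite big_ord_recl.
Qed.

Lemma diff_uptoM V k (U : set V) (f g : V -> R^o) : open U ->
  diff_upto k U f -> diff_upto k U g ->
  diff_upto k U (fun x => f x * g x : R^o).
Proof.
move=> oU; elim: k f g => [|k IH] f g df0 dg0 //.
have [[df Df] [dg Dg]] := (df0, dg0); split=> [x Ux|v].
  by apply: differentiableM; [exact: df|exact: dg].
have H1 := IH _ _ (diff_uptoW df0) (Dg v).
have H2 := IH _ _ (diff_uptoW dg0) (Df v).
apply: eq_diff_upto (diff_uptoD oU H1 H2) => // x Ux.
by rewrite deriveM //; apply: diff_derivable; [exact: df|exact: dg].
Qed.

(** The derivative [- (f x)^-2 * 'D_v f x] again involves only the inverse and a derivative of [f],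
    at one order less, so the induction closes. *)
Lemma diff_uptoV V k (U : set V) (f : V -> R^o) : open U ->
  (forall x, U x -> f x != 0) -> diff_upto k U f ->
  diff_upto k U (fun x => (f x)^-1 : R^o).
Proof.
move=> oU f0; elim: k => // k IH df0.
have [df Df] := df0; split=> [x Ux|v].
  by apply: differentiableV; [exact: df|exact: f0].
have H := IH (diff_uptoW df0).
have H1 := diff_uptoM oU (diff_upto_cst k U (-1 : R^o))
  (diff_uptoM oU (diff_uptoM oU H H) (Df v)).
apply: eq_diff_upto H1 => // x Ux.
rewrite (@deriveV _ _ f x v (f0 x Ux)); last by apply: diff_derivable; exact: df.
by rewrite /cst /= mulN1r -exprVn -mulNr.
Qed.

Lemma diff_upto_rowP V n k (U : set V) (f : V -> 'rV[R]_n) : open U ->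
  diff_upto k U f <-> forall i, diff_upto k U (fun x => f x 0 i : R^o).
Proof.
move=> oU; elim: k f => // k IH f.
have coordE (g : V -> 'rV[R]_n) x : differentiable g x ->
    forall i, differentiable (fun y => g y 0 i : R^o) x.
  move=> dg i; apply: (@differentiable_comp _ _ _ _ g
    (fun M : 'rV[R]_n => M 0 i : R^o)) => //; exact: differentiable_coord.
have rowE (g : V -> 'rV[R]_n) x :
    (forall i, differentiable (fun y => g y 0 i : R^o) x) -> differentiable g x.
  move=> dg.
  rewrite (_ : g = \sum_i (fun y => g y 0 i *: delta_mx 0 i)).
    by apply: differentiable_sum => i; apply: differentiableZl; exact: dg.
  by apply/funext => y; rewrite fct_sumE -row_sum_delta.
have DE x v : differentiable f x -> forall i,
    ('D_v f x) 0 i = 'D_v (fun y => f y 0 i : R^o) x.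
  by move=> df i; rewrite derive_mx ?mxE //; exact: diff_derivable.
split=> [[df Df] i|H].
  split=> [x Ux|v]; first by apply: coordE; exact: df.
  have /IH/(_ i) := Df v; apply: eq_diff_upto => // x Ux.
  by rewrite DE //; exact: df.
have df x : U x -> differentiable f x.
  by move=> Ux; apply: rowE => i; have [+ _] := H i; exact.
split=> // v; apply/IH => i.
have [_ /(_ v)] := H i; apply: eq_diff_upto => // x Ux.
by rewrite DE //; exact: df.
Qed.

Lemma derive_comp_row V W n (f : V -> 'rV[R]_n) (g : 'rV[R]_n -> W) x v :
  differentiable f x -> differentiable g (f x) ->
  'D_v (g \o f) x = \sum_i ('D_v f x) 0 i *: 'D_(delta_mx 0 i) g (f x).
Proof.
move=> df dg; rewrite deriveE; last exact: differentiable_comp.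
rewrite diff_comp //= -(@deriveE _ _ _ f x v df).
rewrite [X in diff _ _ X]row_sum_delta linear_sum.
by apply: eq_bigr => i _; rewrite linearZ /= (@deriveE _ _ _ g (f x) _ dg).
Qed.

(** [diff_upto] iterates derivatives along fixed directions, whereas the chain rule produces the
    direction ['D_v f x], which moves with [x]. Expanding it in the standard basis leaves a finite
    sum of products with fixed directions. *)
Lemma diff_upto_comp V n k (U : set V) (U' : set 'rV[R]_n)
    (f : V -> 'rV[R]_n) (g : 'rV[R]_n -> R^o) : open U ->
  (forall x, U x -> U' (f x)) -> diff_upto k U f -> diff_upto k U' g ->
  diff_upto k U (fun x => g (f x)).
Proof.
move=> oU UU'; elim: k f g UU' => // k IH f g UU' df0 dg0.
have [[df Df] [dg Dg]] := (df0, dg0).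
have dgf x : U x -> differentiable g (f x) by move=> /UU'/dg.
split=> [x Ux|v].
  by apply: differentiable_comp; [exact: df|exact: dgf].
have Df' := (diff_upto_rowP k _ oU).1 (Df v).
have := diff_upto_sum oU (fun i => diff_uptoM oU (Df' i)
  (IH f _ UU' (diff_uptoW df0) (Dg (delta_mx 0 i)))).
apply: eq_diff_upto => // x Ux.
by rewrite [RHS]derive_comp_row//; [exact: df|exact: dgf].
Qed.

Lemma diff_upto_comp_row V n m k (U : set V) (U' : set 'rV[R]_n)
    (f : V -> 'rV[R]_n) (g : 'rV[R]_n -> 'rV[R]_m) : open U -> open U' ->
  (forall x, U x -> U' (f x)) -> diff_upto k U f -> diff_upto k U' g ->
  diff_upto k U (fun x => g (f x)).
Proof.
move=> oU oU' UU' df dg; apply/diff_upto_rowP => // i.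
by apply: (@diff_upto_comp _ _ _ U U' f (fun y => g y 0 i : R^o)) => //;
  exact: (diff_upto_rowP _ _ oU').1 dg i.
Qed.

Lemma diff_upto_pair V W W' k (U : set V) (f : V -> W) (g : V -> W') : open U ->
  diff_upto k U f -> diff_upto k U g ->
  diff_upto k U (fun x => (f x, g x) : W * W')%type.
Proof.
move=> oU; elim: k f g => // k IH f g [df Df] [dg Dg].
have dfg x : U x -> differentiable (fun x => (f x, g x) : W * W')%type x.
  by move=> Ux; apply: differentiable_pair; [exact: df|exact: dg].
split=> // v; apply: eq_diff_upto (IH _ _ (Df v) (Dg v)) => // x Ux.
rewrite [RHS]deriveE; last exact: dfg.
rewrite diff_pair; [|exact: df|exact: dg].
by rewrite /= !deriveE //; [exact: dg|exact: df].
Qed.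

End SmoothCalculus.

(** * Symmetry of second derivatives *)

Section Schwarz.
Context {R : realType}.
Implicit Types V W : normedModType R.

Lemma is_diff_line V (a v : V) (s : R^o) :
  is_diff s (fun t : R^o => t *: v + a) ( *:%R^~ v).
Proof.
have := @is_diffD _ _ _ (fun t : R^o => t *: v) (cst a) _ _ s _ (is_diff_cst a s).
move=> /(_ _ (is_diff_scalel s v)) H.
by apply: is_diff_eq H _; apply/funext => t /=; rewrite addr0.
Qed.

Lemma is_derive_line V W (f : V -> W) (a v : V) (s : R^o) :
  differentiable f (s *: v + a) ->
  is_derive s 1 (fun t : R^o => f (t *: v + a)) ('D_v f (s *: v + a)).
Proof.
move=> df; have dl := is_diff_line a v s.
have dl' : differentiable (fun t : R^o => t *: v + a) s by [].
have dc := differentiable_comp dl' df.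
apply: DeriveDef; first exact: diff_derivable.
rewrite deriveE // diff_comp //= diff_val deriveE //.
by rewrite scale1r.
Qed.

Lemma near0_ball V (P : set V) : (\forall h \near (0 : V), P h) ->
  exists2 d : R, 0 < d & forall h, `|h| < d -> P h.
Proof.
move=> /nbhs_ballP[d /= d0 H]; exists d => // h hd.
by apply: H; rewrite -ball_normE /= sub0r normrN.
Qed.

(** The second difference of [f] over the parallelogram spanned by [t *: v] and [t *: w], divided by
    [t ^+ 2], tends to the mixed derivative. *)
Lemma second_difference V (U : set V) (f : V -> R^o) (x v w : V) :
  open U -> U x -> diff_upto 2 U f -> forall e : R, 0 < e ->
  exists2 d : R, 0 < d & forall t : R, 0 < t -> t < d ->
    `|f (t *: v + (t *: w + x)) - f (t *: v + x) - (f (t *: w + x) - f x)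
       - t ^+ 2 * 'D_w ('D_v f) x| <= e * t ^+ 2.
Proof.
move=> oU Ux [df Df] e e0; set g := 'D_v f.
have [dg _] := Df v.
(* The two remainders below are taken at displacements of total length at most
   [t * (2 * |v| + |w|)]; the 1 makes [K] positive. For [t < d / K] all points used stay within [d]
   of [x]. *)
pose K := 2 * `|v| + `|w| + 1.
have K0 : 0 < K by rewrite /K ltr_pwDr // addr_ge0 // mulr_ge0.
have eK : 0 < e / K by rewrite divr_gt0.
have [/= d1 d10 H1] := near0_ball ((eqaddoP _ _ _ _).1 (diff_locally (dg _ Ux)) _ eK).
have [/= d2 d20 H2] : exists2 d : R, 0 < d & forall h : V, `|h| < d -> U (h + x).
  have /nbhs_ballP[d /= d0 H] := near_in oU Ux.
  exists d => // h hd; apply: H; rewrite -ball_normE /= opprD addrC subrK.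
  by rewrite normrN.
pose d := Num.min d1 d2.
have d0 : 0 < d by rewrite lt_min d10.
exists (d / K); first exact: divr_gt0.
move=> t t0; rewrite ltr_pdivlMr // => tK.
have in_d s c : 0 <= s -> s <= t -> 0 <= c -> c <= t -> `|s *: v + c *: w| < d.
  move=> s0 st c0 ct; apply: le_lt_trans tK.
  rewrite (le_trans (ler_normD _ _)) // !normrZ !ger0_norm // /K.
  have : s * `|v| <= t * `|v| by rewrite ler_wpM2r.
  have : c * `|w| <= t * `|w| by rewrite ler_wpM2r.
  have : 0 <= t * `|v| by rewrite mulr_ge0 // ltW.
  by rewrite !mulrDr mulr1 mulrCA; lra.
have inU s c : 0 <= s -> s <= t -> 0 <= c -> c <= t ->
    U (s *: v + (c *: w + x)).
  move=> s0 st c0 ct; rewrite addrA; apply: H2.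
  by rewrite (lt_le_trans (in_d _ _ _ _ _ _)) // ge_min lexx orbT.
have in_g s c : 0 <= s -> s <= t -> 0 <= c -> c <= t ->
    `|g (s *: v + (c *: w + x)) - g x - 'd g x (s *: v + c *: w)|
    <= e / K * `|s *: v + c *: w|.
  move=> s0 st c0 ct.
  have := H1 (s *: v + c *: w); rewrite opprD addrA.
  rewrite addrA; apply.
  by rewrite (lt_le_trans (in_d _ _ _ _ _ _)) // ge_min lexx.
(* The mean value theorem for [phi] expresses the second difference through the
   derivative [g], which is differentiable at [x]. *)
pose phi (s : R^o) : R^o := f (s *: v + (t *: w + x)) - f (s *: v + x).
pose dphi (s : R^o) : R^o := g (s *: v + (t *: w + x)) - g (s *: v + x).
have phiD s : 0 <= s -> s <= t -> is_derive s 1 phi (dphi s).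
  move=> s0 st; apply: is_deriveB; apply: is_derive_line; apply: df.
    by apply: inU => //; exact: ltW.
  by have := inU s 0 s0 st (lexx _) (ltW t0); rewrite scale0r add0r.
have [||s st phiE] := @MVT _ phi dphi 0 t t0.
- by move=> s; rewrite in_itv /= => /andP[/ltW s0 /ltW st]; exact: phiD.
- apply: derivable_within_continuous => s; rewrite in_itv /= => /andP[s0 st].
  by have [] := phiD s s0 st.
move: st; rewrite in_itv /= => /andP[/ltW s0 /ltW st].
rewrite -[X in `|X - _|]/(phi t - (f (t *: w + x) - f x)).
have -> : f (t *: w + x) - f x = phi 0 by rewrite /phi !scale0r !add0r.
rewrite phiE subr0 /dphi deriveE; last exact: dg.
(* By linearity of ['d g x] the contributions of [s *: v] cancel, which leaves the difference of two
   first-order remainders of [g] at [x]. *)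
have -> : (g (s *: v + (t *: w + x)) - g (s *: v + x)) * t - t ^+ 2 * 'd g x w
  = t * ((g (s *: v + (t *: w + x)) - g x - 'd g x (s *: v + t *: w)) -
      (g (s *: v + (0 *: w + x)) - g x - 'd g x (s *: v + 0 *: w))).
  rewrite !linearD !linearZ /= scale0r add0r /GRing.scale /=; ring.
rewrite normrM gtr0_norm // expr2 mulrCA ler_pM2l //.
have I1 := in_g s t s0 st (ltW t0) (lexx _).
have I2 := in_g s 0 s0 st (lexx _) (ltW t0).
rewrite (le_trans (ler_normB _ _)) // (le_trans (lerD I1 I2)) //.
rewrite -mulrDr -mulrA ler_pM2l // ler_pdivrMl // scale0r addr0.
rewrite (le_trans (lerD (ler_normD _ _) (lexx _))) // !normrZ !ger0_norm ?(ltW t0) //.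
have : s * `|v| <= t * `|v| by rewrite ler_wpM2r.
by rewrite /K; nra.
Qed.

(** The second difference is symmetric in [v] and [w], so both mixed derivatives are limits of the
    same quotient. *)
Lemma derive_derive_sym V (U : set V) (f : V -> R^o) (x v w : V) :
  open U -> U x -> diff_upto 2 U f ->
  'D_w ('D_v f) x = 'D_v ('D_w f) x.
Proof.
move=> oU Ux df; apply/eqP; rewrite -subr_eq0 -normr_le0; apply/ler_addgt0Pl.
move=> e e0; rewrite addr0.
have e2 : 0 < e / 2 by rewrite divr_gt0.
have [d1 d10 H1] := second_difference v w oU Ux df e2.
have [d2 d20 H2] := second_difference w v oU Ux df e2.
pose t := Num.min d1 d2 / 2.
have t0 : 0 < t by rewrite divr_gt0 // lt_min d10.
have tm : t < Num.min d1 d2 by rewrite ltr_pdivrMr // ltr_pMr ?lt_min ?d10 // ltr1n.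
have := H1 t t0; rewrite (lt_le_trans tm) ?ge_min ?lexx // => /(_ isT).
have := H2 t t0; rewrite (lt_le_trans tm) ?ge_min ?lexx ?orbT // => /(_ isT).
rewrite (addrCA (t *: v)).
set a := f _; set b := f _; set c := f _; set d := f _.
set A := 'D_w ('D_v f) x; set B := 'D_v ('D_w f) x => I1 I2.
have t2 : 0 < t ^+ 2 by rewrite exprn_gt0.
have := lerD I1 I2; rewrite -mulrDl -splitr => I.
rewrite -(ler_pM2r t2) (le_trans _ I) // -[X in _ * X](gtr0_norm t2) -normrM.
rewrite (le_trans _ (ler_normB _ _)) //.
have aux (a' b' c' d' A' B' s : R) : (A' - B') * s ^+ 2 =
    a' - b' - (c' - d') - s ^+ 2 * B' - (a' - c' - (b' - d') - s ^+ 2 * A').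
  by ring.
by rewrite le_eqVlt; apply/orP; left; apply/eqP; congr (`| _ |); exact: aux.
Qed.

Lemma derive_derive_row_sym V n (U : set V) (f : V -> 'rV[R]_n) (x v w : V) :
  open U -> U x -> diff_upto 2 U f ->
  'D_w ('D_v f) x = 'D_v ('D_w f) x.
Proof.
move=> oU Ux df; apply/rowP => i.
have [df1 Df1] := df.
have DE u y : U y -> ('D_u f y) 0 i = 'D_u (fun y => f y 0 i : R^o) y.
  by move=> Uy; rewrite derive_mx ?mxE //; apply: diff_derivable; exact: df1.
have DDE u u' : ('D_u' ('D_u f) x) 0 i = 'D_u' ('D_u (fun y => f y 0 i : R^o)) x.
  rewrite derive_mx ?mxE; last first.
    by apply: diff_derivable; have [+ _] := Df1 u; exact.
  by apply: eq_derive_on oU Ux _ => y; exact: DE.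
apply: (etrans (DDE v w)); apply: (etrans _ (esym (DDE w v))).
apply: (derive_derive_sym _ _ oU Ux).
exact: ((diff_upto_rowP 2 f oU).1 df i).
Qed.

End Schwarz.

(** * The inverse function theorem *)

Section InverseFunction.
Context {R : realType}.
Implicit Types V W : normedModType R.

Lemma row_norm_le n (x : 'rV[R]_n) (c : R) :
  0 <= c -> (forall i, `|x 0 i| <= c) -> `|x| <= c.
Proof.
move=> c0 xc; rewrite [leLHS]/Num.Def.normr /= mx_normrE; apply: bigmax_le => //=.
by move=> [i j] _ /=; rewrite ord1.
Qed.

Lemma coord_norm_le n (x : 'rV[R]_n) i : `|x 0 i| <= `|x|.
Proof.
by rewrite [leRHS]/Num.Def.normr /= mx_normrE; exact: (le_bigmax _ _ (0, i)).
Qed.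

Lemma derive_coord V n (f : V -> 'rV[R]_n) x v i : differentiable f x ->
  'D_v (fun y => f y 0 i : R^o) x = ('D_v f x) 0 i.
Proof. by move=> df; rewrite derive_mx ?mxE //; exact: diff_derivable. Qed.

Lemma differentiable_entry V n (f : V -> 'rV[R]_n) x i : differentiable f x ->
  differentiable (fun y => f y 0 i : R^o) x.
Proof.
move=> df; apply: (@differentiable_comp _ _ _ _ f
  (fun M : 'rV[R]_n => M 0 i : R^o)) => //; exact: differentiable_coord.
Qed.

(** The mean value theorem is applied to each coordinate separately. As row vectors carry the
    maximum norm, the bound survives without a dimensional constant. *)
Lemma mean_value_row V n (f : V -> 'rV[R]_n) (a b : V) (c : R) : 0 <= c ->
  (forall s : R, 0 <= s <= 1 -> differentiable f (s *: (b - a) + a)) ->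
  (forall s : R, 0 <= s <= 1 -> `|'D_(b - a) f (s *: (b - a) + a)| <= c) ->
  `|f b - f a| <= c.
Proof.
move=> c0 df Df; apply: row_norm_le => // i.
pose phi (s : R^o) : R^o := f (s *: (b - a) + a) 0 i.
pose dphi (s : R^o) : R^o := ('D_(b - a) f (s *: (b - a) + a)) 0 i.
have phiD (s : R) : 0 <= s <= 1 -> is_derive (s : R^o) 1 phi (dphi s).
  move=> s01; rewrite /dphi -derive_coord; last exact: df.
  apply: (@is_derive_line _ _ _ (fun y => f y 0 i : R^o)).
  exact/differentiable_entry/df.
have [||s s01 phiE] := @MVT _ phi dphi 0 1 ltr01.
- move=> s; rewrite in_itv /= => /andP[/ltW s0 /ltW s1].
  by apply: phiD; rewrite s0.
- apply: derivable_within_continuous => s; rewrite in_itv /= => s01.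
  by have [] := phiD s s01.
have -> : (f b - f a) 0 i = phi 1 - phi 0.
  by rewrite /phi scale1r scale0r add0r subrK !mxE.
rewrite phiE subr0 mulr1 (le_trans (coord_norm_le _ _)) //; apply: Df.
by move: s01; rewrite in_itv /= => /andP[/ltW -> /ltW ->].
Qed.

Lemma closed_ball_convex V (u0 u u' : V) (d s : R) : 0 <= s <= 1 ->
  `|u - u0| <= d -> `|u' - u0| <= d -> `|s *: (u - u') + u' - u0| <= d.
Proof.
move=> /andP[s0 s1] ud ud'.
have -> : s *: (u - u') + u' - u0 = s *: (u - u0) + (1 - s) *: (u' - u0).
  by rewrite scalerBl scale1r addrCA -scalerBr opprB subrKA -addrA addrC.
rewrite (le_trans (ler_normD _ _)) // !normrZ (ger0_norm s0) ger0_norm ?subr_ge0//.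
have := ler_wpM2l s0 ud.
have s1' : 0 <= 1 - s by rewrite subr_ge0.
by have := ler_wpM2l s1' ud'; lra.
Qed.

Lemma near_identity n (U : set 'rV[R]_n) (h : 'rV[R]_n -> 'rV[R]_n) u0 :
  open U -> U u0 -> diff_upto 2 U h -> (forall v, 'D_v h u0 = v) ->
  exists d : R, [/\ 0 < d, (forall u, `|u - u0| <= d -> U u),
    (forall u v, `|u - u0| <= d -> `|'D_v h u - v| <= `|v| / 2) &
    (forall u u', `|u - u0| <= d -> `|u' - u0| <= d ->
       `|h u - h u' - (u - u')| <= `|u - u'| / 2)].
Proof.
move=> oU Uu0 [dh Dh] h1.
(* The [n] partial derivatives each contribute an error of at most [|v| * e], in total at most
   [|v| / 2]; the successor covers [n = 0]. *)
pose e : R := (2 * n.+1%:R)^-1.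
have e0 : 0 < e by rewrite invr_gt0 mulr_gt0.
have Dnear : \forall u \near u0, forall i : 'I_n,
    `|'D_(delta_mx 0 i) h u - delta_mx 0 i| < e.
  near=> u => i; move: i; near: u; apply: filter_forall => /= i.
  have [/(_ _ Uu0)/differentiable_continuous + _] := Dh (delta_mx 0 i).
  move=> /cvgrPdist_lt/(_ _ e0); apply: filterS => u.
  by rewrite /= h1 distrC.
have : \forall u \near u0, U u /\ forall i : 'I_n,
    `|'D_(delta_mx 0 i) h u - delta_mx 0 i| < e.
  by apply: filterS2 (near_in oU Uu0) Dnear => u.
move=> /nbhs_ballP[d0 /= d00 H].
have d02 : 0 < d0 / 2 by rewrite divr_gt0.
have {}H u : `|u - u0| <= d0 / 2 -> U u /\ forall i : 'I_n,
    `|'D_(delta_mx 0 i) h u - delta_mx 0 i| < e.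
  move=> ud; apply: H; rewrite -ball_normE /= distrC (le_lt_trans ud) //.
  by rewrite ltr_pdivrMr // ltr_pMr // ltr1n.
have HD u v : `|u - u0| <= d0 / 2 -> `|'D_v h u - v| <= `|v| / 2.
  move=> /H[Uu Hu].
  have -> : 'D_v h u - v =
      \sum_i v 0 i *: ('D_(delta_mx 0 i) h u - delta_mx 0 i).
    rewrite deriveE; last exact: dh.
    rewrite [X in diff _ _ X - X](row_sum_delta v) linear_sum -sumrB.
    apply: eq_bigr => i _; rewrite linearZ scalerBr /= deriveE //; exact: dh.
  rewrite (le_trans (ler_norm_sum _ _ _)) //.
  apply: (@le_trans _ _ (\sum_(i < n) `|v| * e)).
    apply: ler_sum => i _; rewrite normrZ ler_pM // ?coord_norm_le //.
    exact/ltW/Hu.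
  rewrite sumr_const card_ord -mulrnAr ler_wpM2l // -mulr_natr.
  rewrite /e invfM -mulrA ger_pMr ?invr_gt0 // mulrC ler_pdivrMr // mul1r.
  by rewrite ler_nat.
exists (d0 / 2); split => //; first by move=> u /H[].
move=> u u' ud ud'.
have -> : h u - h u' - (u - u') = (h \- id) u - (h \- id) u'.
  by rewrite /= !opprB addrACA [RHS]addrACA; congr (_ + _); rewrite addrC.
have Hs (s : R) s01 := @closed_ball_convex _ u0 u u' (d0 / 2) s s01 ud ud'.
apply: (@mean_value_row _ n (h \- id) u' u) => [|s /Hs sd|s /Hs sd].
- by rewrite divr_ge0.
- by apply: differentiableB => //; apply: dh; have [] := H _ sd.
- have -> : 'D_(u - u') (h \- id) (s *: (u - u') + u') =
      'D_(u - u') h (s *: (u - u') + u') - (u - u').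
    have dhs : derivable h (s *: (u - u') + u') (u - u').
      by apply: diff_derivable; apply: dh; have [] := H _ sd.
    by rewrite (deriveB dhs (@derivable_id _ _ _ _)) derive_id.
  by apply: HD; exact: sd.
Unshelve. all: by end_near. Qed.

End InverseFunction.

(** * Existence and smoothness of local inverses *)

Section LocalInverse.
Context {R : realType}.
Implicit Types V W : normedModType R.

Lemma diff_upto_det V n k (U : set V) (A : V -> 'M[R]_n) : open U ->
  (forall i j, diff_upto k U (fun x => A x i j : R^o)) ->
  diff_upto k U (fun x => \det (A x) : R^o).
Proof.
move=> oU; elim: n A => [|n IH] A dA.
  apply: (eq_diff_upto oU _ (diff_upto_cst k U (1 : R^o))) => x _.
  by rewrite det_mx00.
have H j : diff_upto k U (fun x => A x 0 j * cofactor (A x) 0 j : R^o).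
  apply: diff_uptoM => //; apply: diff_uptoM => //; first exact: diff_upto_cst.
  apply: IH => i' j'; apply: (eq_diff_upto oU _ (dA (lift 0 i') (lift j j'))).
  by move=> x _; rewrite !mxE.
apply: eq_diff_upto (diff_upto_sum oU H) => // x _.
by rewrite (expand_det_row _ 0).
Qed.

(** Cramer's rule: adjugate and determinant are polynomials in the entries. *)
Lemma diff_upto_invmx V n k (U : set V) (A : V -> 'M[R]_n) i j : open U ->
  (forall x, U x -> A x \in unitmx) ->
  (forall i j, diff_upto k U (fun x => A x i j : R^o)) ->
  diff_upto k U (fun x => invmx (A x) i j : R^o).
Proof.
move=> oU Au dA.
have det0 x : U x -> \det (A x) != 0 by move=> /Au; rewrite unitmxE unitfE.
have H1 := diff_uptoV oU det0 (diff_upto_det oU dA).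
have H2 : diff_upto k U (fun x => \adj (A x) i j : R^o).
  apply: (@eq_diff_upto _ _ _ _ _ (fun x => cofactor (A x) j i : R^o)) => //.
    by move=> x _; rewrite mxE.
  apply: diff_uptoM => //; first exact: diff_upto_cst.
  apply: diff_upto_det => // i' j'.
  apply: (eq_diff_upto oU _ (dA (lift j i') (lift i j'))).
  by move=> x _; rewrite !mxE.
apply: eq_diff_upto (diff_uptoM oU H1 H2) => // x Ux.
by rewrite /invmx Au // [RHS]mxE.
Qed.

Section NearIdentity.
Variables (n : nat) (U : set 'rV[R]_n) (h : 'rV[R]_n -> 'rV[R]_n).
Variables (u0 : 'rV[R]_n) (d : R).
Hypotheses (oU : open U) (hU : smooth_on U h) (d0 : 0 < d).
Hypothesis BU : forall u, `|u - u0| <= d -> U u.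
Hypothesis Dh : forall u v, `|u - u0| <= d -> `|'D_v h u - v| <= `|v| / 2.
Hypothesis hlip : forall u u', `|u - u0| <= d -> `|u' - u0| <= d ->
  `|h u - h u' - (u - u')| <= `|u - u'| / 2.

Let dh u : `|u - u0| <= d -> differentiable h u.
Proof. by move=> ud; have [+ _] := hU 1; apply; exact: BU. Qed.

Lemma near_identity_expand u u' : `|u - u0| <= d -> `|u' - u0| <= d ->
  `|u - u'| <= 2 * `|h u - h u'|.
Proof.
move=> ud ud'; have := hlip ud ud'.
have := ler_normB (h u - h u') (h u - h u' - (u - u')).
by rewrite opprB addrC subrK; lra.
Qed.

(** A minimiser of [|h u - y|] on the closed ball exists by compactness. It satisfies
    [|u - u0| <= 4 * |y - h u0|], so the radius [d / 4] keeps it off the boundary and leaves room to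
    move it. *)
Lemma near_identity_surj y : `|y - h u0| < d / 4 ->
  exists2 u, `|u - u0| < d & h u = y.
Proof.
move=> yd; pose B := closed_ball u0 d.
have BE u : B u <-> `|u - u0| <= d.
  by rewrite /B closed_ballE // /closed_ball_ /= distrC.
have B0 : B u0 by apply/BE; rewrite subrr normr0 ltW.
have cB : compact B.
  apply: bounded_closed_compact; last exact: closed_ball_closed.
  exists (`|u0| + d); split; first exact: num_real.
  move=> x xd u /BE ud; rewrite /= (le_trans _ (ltW xd)) //.
  rewrite -[X in `|X|](subrK u0) (le_trans (ler_normD _ _)) // addrC.
  by rewrite lerD2l.
have [||u + umin] := @EVT_min_rV _ _ (fun u => `|h u - y|) B _ cB.
- by exists u0.
- apply: continuous_in_subspaceT => u; rewrite inE => /BE ud.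
  have hc := differentiable_continuous (dh ud).
  exact: (cvg_norm (cvgB hc (cvg_cst y))).
rewrite inE => /BE ud.
have {}umin v : `|v - u0| <= d -> `|h u - y| <= `|h v - y|.
  by move=> vd; apply: umin; rewrite inE; exact/BE.
have u0d : `|u0 - u0| <= d by rewrite subrr normr0 ltW.
have ud' : `|u - u0| < d.
  have := near_identity_expand ud u0d.
  have := umin _ u0d; rewrite (distrC (h u0)).
  have := ler_normD (h u - y) (y - h u0); rewrite subrKA.
  by move: d0 yd; lra.
(* If [h u <> y], then moving [u] slightly along [y - h u] decreases [`|h u - y|]. *)
exists u => //; apply/eqP; rewrite -subr_eq0 -normr_eq0; apply/negPn/negP => hy.
have hy0 : 0 < `|h u - y| by rewrite lt_def hy normr_ge0.
(* The bound 1 keeps [1 - t] nonnegative, the other one keeps [v] in the ball. Then [hlip] yields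
   [|h v - y| <= (1 - t / 2) * |h u - y|], against minimality. *)
pose t := Num.min 1 ((d - `|u - u0|) / `|h u - y|).
have t0 : 0 < t by rewrite lt_min ltr01 divr_gt0 // subr_gt0.
have t1 : t <= 1 by rewrite ge_min lexx.
have td : t * `|h u - y| <= d - `|u - u0|.
  by rewrite -ler_pdivlMr // ge_min lexx orbT.
pose v := u - t *: (h u - y).
have vd : `|v - u0| <= d.
  rewrite /v addrAC (le_trans (ler_normB _ _)) // normrZ gtr0_norm //.
  by move: td; lra.
have vu : v - u = - (t *: (h u - y)) by rewrite /v addrAC subrr add0r.
have := hlip vd ud; rewrite vu normrN normrZ gtr0_norm // opprK.
have := umin _ vd.
have -> : h v - y = (h v - h u + t *: (h u - y)) + (1 - t) *: (h u - y).
  by rewrite scalerBl scale1r addrACA subrr addr0 subrKA.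
move=> I1 I2; have := le_trans I1 (ler_normD _ _).
have s0 : 0 <= 1 - t by rewrite subr_ge0.
rewrite normrZ (ger0_norm s0) => I3.
have := mulr_gt0 t0 hy0; move: I2 I3; set a := `|h u - y|; set b := `|_ + _|.
by nra.
Qed.

Definition near_inverse (y : 'rV[R]_n) : 'rV[R]_n :=
  xget u0 [set u | `|u - u0| < d /\ h u = y].

Let V := ball (h u0) (d / 4).

Let VE y : V y -> `|y - h u0| < d / 4.
Proof. by rewrite /V -ball_normE /= distrC. Qed.

Let oV : open V.
Proof. by apply: ball_open; rewrite divr_gt0. Qed.

Lemma near_inverseP y : V y ->
  `|near_inverse y - u0| < d /\ h (near_inverse y) = y.
Proof.
move=> /VE/near_identity_surj[u ud hu].
by apply: (@xgetPex _ u0 [set u | `|u - u0| < d /\ h u = y]); exists u.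
Qed.

Lemma near_inverse_jacobian u : `|u - u0| <= d -> jacobian h u \in unitmx.
Proof.
move=> ud; rewrite -row_free_unit; apply: inj_row_free => v vJ.
have := Dh v ud; rewrite (deriveEjacobian v (dh ud)) vJ sub0r normrN => I.
by apply/normr0_eq0/le_anti; rewrite normr_ge0 andbT; move: (normr_ge0 v) I; lra.
Qed.

Lemma near_inverse_diff y : V y ->
  is_diff y near_inverse (mulmxr (invmx (jacobian h (near_inverse y)))).
Proof.
move=> Vy; have [kd hk] := near_inverseP Vy.
have kd' := ltW kd; set u := near_inverse y in kd hk kd' *.
have Ju := near_inverse_jacobian kd'.
have invJ (w : 'rV[R]_n) : `|w *m invmx (jacobian h u)| <= 2 * `|w|.
  have := Dh (w *m invmx (jacobian h u)) kd'.
  rewrite (deriveEjacobian _ (dh kd')) mulmxKV // => I.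
  have := ler_normB w (w - w *m invmx (jacobian h u)).
  by rewrite opprB addrC subrK; move: I; lra.
apply: is_diff_eps.
  apply/linear_bounded_continuous/linear_boundedP.
  exists 2; split=> [|r r2 w /=]; first exact: num_real.
  by rewrite (le_trans (invJ w)) // ler_wpM2r // ltW.
move=> e e0.
(* Two factors 2 are lost: one to the inverse Jacobian ([invJ]), one to [|u' - u| <= 2 * |w|]. *)
have e4 : 0 < e / 4 by rewrite divr_gt0.
have [/= d1 d10 H1] :=
  near0_ball ((eqaddoP _ _ _ _).1 (diff_locally (dh kd')) _ e4).
have V0 : \forall w \near (0 : 'rV[R]_n), V (w + y).
  by have := near_in oV Vy; rewrite (near_shift 0); apply: filterS => w /=; rewrite subr0.
have N0 : \forall w \near (0 : 'rV[R]_n), `|w| < d1 / 2.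
  by apply: nbhs0_lt; rewrite divr_gt0.
apply: filterS2 V0 N0 => w Vw wd.
have [kd2 hk2] := near_inverseP Vw; set u' := near_inverse (w + y) in kd2 hk2 *.
have I1 := near_identity_expand (ltW kd2) kd'.
have wE : w = h u' - h u by rewrite hk hk2 addrK.
rewrite -wE in I1.
have ud1 : `|u' - u| < d1 by rewrite (le_lt_trans I1) // -ltr_pdivlMl // mulrC.
have I2 : `|h (u' - u + u) - h u - 'd h u (u' - u)| <= e / 4 * `|u' - u|.
  by have := H1 _ ud1; rewrite opprD addrA.
rewrite subrK -wE -(deriveE _ (dh kd')) (deriveEjacobian _ (dh kd')) in I2.
rewrite -/u' -(mulmxK Ju (u' - u)) /= -mulmxBl (le_trans (invJ _)) //.
rewrite distrC.
have : e / 4 * `|u' - u| <= e / 4 * (2 * `|w|) by rewrite ler_wpM2l // ltW.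
by move: I2; lra.
Qed.

(** Bootstrapping: the derivative of the inverse is a smooth function [M] of the point composed with
    the inverse itself, so each order of differentiability gives the next. *)
Lemma near_inverse_smooth : smooth_on V near_inverse.
Proof.
have oB : open (ball u0 d) by apply: ball_open.
have BE u : ball u0 d u -> `|u - u0| < d by rewrite -ball_normE /= distrC.
have BU' : ball u0 d `<=` U by move=> u /BE/ltW/BU.
elim=> [//|k IH]; split=> [y /near_inverse_diff[]//|w].
pose M u := w *m invmx (jacobian h u).
have sM : diff_upto k (ball u0 d) M.
  apply/diff_upto_rowP => // j.
  have H i : diff_upto k (ball u0 d)
      (fun u => w 0 i * invmx (jacobian h u) i j : R^o).
    apply: diff_uptoM => //; first exact: diff_upto_cst.
    apply: diff_upto_invmx => // [u /BE/ltW|i' j'].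
      exact: near_inverse_jacobian.
    have [_ /(_ (delta_mx 0 i')) H] := hU k.+1.
    have {}H := sub_diff_upto BU' H.
    apply: (eq_diff_upto oB _ ((diff_upto_rowP _ _ oB).1 H j')) => u /BE/ltW ud.
    by rewrite (deriveEjacobian _ (dh ud)) -rowE mxE.
  by apply: (eq_diff_upto oB _ (diff_upto_sum oB H)) => u _; rewrite mxE.
apply: (eq_diff_upto oV _ (diff_upto_comp_row oV oB _ IH sM)).
  move=> y Vy; have [dk ek] := near_inverse_diff Vy.
  by rewrite (deriveE w dk) ek.
by move=> y /near_inverseP[+ _]; rewrite -ball_normE /= distrC.
Qed.

(** On the ball [h] stretches distances by at most 3/2, so the radius [d / 8] ends up within [d / 4]
    of [h u0]; [near_identity_expand] then makes the preimage unique. *)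
Lemma near_inverseK u : `|u - u0| < d / 8 ->
  ball (h u0) (d / 4) (h u) /\ near_inverse (h u) = u.
Proof.
move=> ud.
have ud1 : `|u - u0| < d by rewrite (lt_trans ud) // ltr_pdivrMr // ltr_pMr // ltr1n.
have u0d : `|u0 - u0| <= d by rewrite subrr normr0 ltW.
have Vu : V (h u).
  rewrite /V -ball_normE /= distrC.
  have := hlip (ltW ud1) u0d; have := ler_normD (h u - h u0 - (u - u0)) (u - u0).
  by rewrite subrK; move: ud; lra.
split=> //; have [kd hk] := near_inverseP Vu.
apply/eqP; rewrite -subr_eq0 -normr_le0.
have := near_identity_expand (ltW kd) (ltW ud1).
by rewrite hk subrr normr0 mulr0.
Qed.

End NearIdentity.

(** The derivative is normalised to the identity because a chart is composed with a left inverse of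
    its Jacobian before this is applied. *)
Lemma local_inverse n (U : set 'rV[R]_n) (h : 'rV[R]_n -> 'rV[R]_n) u0 :
  open U -> U u0 -> smooth_on U h -> (forall v, 'D_v h u0 = v) ->
  exists (O B : set 'rV[R]_n) (k : 'rV[R]_n -> 'rV[R]_n),
    [/\ open O /\ open B, B u0, B `<=` U, smooth_on O k &
     (forall y, O y -> U (k y)) /\ forall u, B u -> O (h u) /\ k (h u) = u].
Proof.
move=> oU Uu0 hU h1.
have [d [d0 BU Dh hlip]] := near_identity oU Uu0 (hU 2) h1.
exists (ball (h u0) (d / 4)), (ball u0 (d / 8)), (near_inverse h u0 d).
have BE u : ball u0 (d / 8) u -> `|u - u0| < d / 8.
  by rewrite -ball_normE /= distrC.
split.
- by split; apply: ball_open; rewrite divr_gt0.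
- by apply: ballxx; rewrite divr_gt0.
- move=> u /BE ud; apply: BU; rewrite (le_trans (ltW ud)) //.
  by rewrite ler_pdivrMr // ler_pMr // ler1n.
- exact: (near_inverse_smooth hU).
- split=> [y /(near_inverseP hU d0 BU hlip)[/ltW/BU]//|u /BE].
  exact: (near_inverseK hU).
Qed.

End LocalInverse.

(** * Local parametrisations *)

Section Charts.
Context {R : realType}.
Implicit Types V W : normedModType R.

Lemma diff_upto_local V W k (U : set V) (f : V -> W) :
  (forall x, U x -> exists N, [/\ open N, N x & diff_upto k N f]) ->
  diff_upto k U f.
Proof.
elim: k f => // k IH f H; split=> [x /H[N [_ Nx [df _]]]|v]; first exact: df.
apply: IH => x /H[N [oO Nx [_ Df]]]; exists N; split=> //; exact: Df.
Qed.

Lemma smooth_mulmxr m n (M : 'M[R]_(m, n)) (U : set 'rV[R]_m) :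
  open U -> smooth_on U (mulmxr M : 'rV[R]_m -> 'rV[R]_n).
Proof.
move=> oU k; apply/diff_upto_rowP => // j.
have H i : diff_upto k U (fun u : 'rV[R]_m => u 0 i * M i j : R^o).
  apply: diff_uptoM => //; last exact: diff_upto_cst.
  apply: ((diff_upto_rowP k (@idfun 'rV[R]_m) oU).1 _ i).
  by apply: diff_upto_linear => x; exact: cvg_id.
by apply: (eq_diff_upto oU _ (diff_upto_sum oU H)) => u _; rewrite /= mxE.
Qed.

Lemma continuous_mulmxr m n (M : 'M[R]_(m, n)) :
  continuous (mulmxr M : 'rV[R]_m -> 'rV[R]_n).
Proof.
move=> x; apply: differentiable_continuous.
by have [+ _] := smooth_mulmxr M openT 1; exact.
Qed.

Lemma smooth_on_continuous V W (U : set V) (f : V -> W) x :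
  smooth_on U f -> U x -> {for x, continuous f}.
Proof.
by move=> fU Ux; apply: differentiable_continuous; have [+ _] := fU 1; exact.
Qed.

Lemma smooth_on_differentiable V W (U : set V) (f : V -> W) x :
  smooth_on U f -> U x -> differentiable f x.
Proof. by move=> fU Ux; have [+ _] := fU 1; exact. Qed.

Lemma open_preimage V W (U : set V) (f : V -> W) (N : set W) : open U ->
  (forall x, U x -> {for x, continuous f}) -> open N ->
  open (U `&` f @^-1` N).
Proof.
move=> oU fc oO; rewrite openE => x [Ux Ofx]; apply: filterI.
  exact: near_in.
by apply: fc => //; exact: near_in.
Qed.

Lemma smooth_line V (a v : V) (I : set R^o) : open I ->
  smooth_on I (fun t : R^o => t *: v + a).
Proof.
move=> oI [//|k]; split=> [t _|w]; first by have [] := is_diff_line a v t.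
apply: (eq_diff_upto oI _ (diff_upto_cst k I (w *: v))) => t _.
by have [dl el] := is_diff_line a v t; rewrite (deriveE w dl) el.
Qed.

Lemma derive1_comp_curve V W (c : R^o -> V) (F : V -> W) :
  differentiable c 0 -> differentiable F (c 0) ->
  derive1 (F \o c) 0 = 'D_(derive1 c 0) F (c 0).
Proof.
move=> dc dF; rewrite derive1E' ?derive1E' //; last exact: differentiable_comp.
by rewrite diff_comp // deriveE.
Qed.

Variables (m n : nat) (L : set 'rV[R]_m) (U : set 'rV[R]_n).
Variable f : 'rV[R]_n -> 'rV[R]_m.
Hypothesis param : local_param L U f.

Lemma param_open : open U. Proof. by case: param. Qed.

Lemma param_smooth : smooth_on U f. Proof. by case: param. Qed.

Lemma param_differentiable u : U u -> differentiable f u.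
Proof. exact: smooth_on_differentiable param_smooth. Qed.

Lemma param_mem u : U u -> L (f u).
Proof.
case: param => oU _ _ _ /(_ U oU (@subset_refl _ _))[N _ E] Uu.
by have [] : (L `&` N) (f u) by rewrite -E; exists u.
Qed.

(** With [A] a linear left inverse of the Jacobian, [A \o f] has derivative the identity at [u0] and
    thus a smooth local inverse [k]; take [r := k \o A]. The openness clause of [local_param]
    supplies an ambient open set in which every point of [L] comes from the part [B] of the chart
    where [k] inverts [A \o f]; without it another sheet of [L] could pass close to [f u0]. *)
Lemma local_retraction u0 : U u0 ->
  exists (N : set 'rV[R]_m) (r : 'rV[R]_m -> 'rV[R]_n),
  [/\ open N, N (f u0), smooth_on N r, (forall x, N x -> U (r x)) &
      forall x, N x -> L x -> f (r x) = x].
Proof.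
move=> Uu0; have [oU sf finj dfinj fopen] := param.
have df0 := param_differentiable Uu0.
pose J := jacobian f u0.
have Jfree : row_free J.
  apply: inj_row_free => v; rewrite -deriveEjacobian // deriveE // => v0.
  by apply: (dfinj _ Uu0); rewrite linear0.
pose A := mulmxr (pinvmx J) : 'rV[R]_m -> 'rV[R]_n.
have sA := smooth_mulmxr (pinvmx J) openT.
have sh : smooth_on U (A \o f).
  move=> k; exact: (diff_upto_comp_row oU openT _ (sf k) (sA k)).
have h1 v : 'D_v (A \o f) u0 = v.
  have dA : differentiable A (f u0) by exact: smooth_on_differentiable sA _.
  rewrite deriveE; last exact: differentiable_comp.
  rewrite diff_comp //= -(deriveE v df0) deriveEjacobian // -/J.
  rewrite /A diff_lin /=; last exact: continuous_mulmxr.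
  by rewrite -mulmxA mulmxVp // mulmx1.
have [N1 [B [k [[oOk oB] Bu0 BU sk [kU kK]]]]] := local_inverse oU Uu0 sh h1.
have [P1 oP1 fB] := fopen B oB BU.
exists (P1 `&` A @^-1` N1), (k \o A).
have oO : open (P1 `&` A @^-1` N1).
  apply: (@open_preimage _ _ P1 A N1 oP1 _ oOk) => x _.
  exact: (@continuous_mulmxr _ _ (pinvmx J) x).
split=> //.
- split; last by have [] := kK _ Bu0.
  by have : (L `&` P1) (f u0) by [rewrite -fB; exists u0] => -[].
- move=> j; apply: (diff_upto_comp_row oO oOk _ _ (sk j)); first by move=> x [].
  exact: smooth_mulmxr.
- by move=> x [_ /kU].
- move=> x [P1x _] Lx.
  have : (f @` B) x by rewrite fB.
  by move=> [u Bu <-] /=; have [_ ->] := kK _ Bu.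
Qed.

Lemma retraction_paramK (N : set 'rV[R]_m) (r : 'rV[R]_m -> 'rV[R]_n) u : U u ->
  (forall x, N x -> U (r x)) -> (forall x, N x -> L x -> f (r x) = x) ->
  N (f u) -> r (f u) = u.
Proof.
move=> Uu rU fr Ofu; have [_ _ finj _ _] := param.
by apply: finj => //; [exact: rU|apply: fr => //; exact: param_mem].
Qed.

Lemma curve_differentiable V (M : set V) p v (c : R^o -> V) :
  curve_in M p v c -> differentiable c 0.
Proof. by move=> [[I [_ I0 sc _]] _]; exact: smooth_on_differentiable sc I0. Qed.

Lemma tangentP u v : U u -> tangent L (f u) v <-> exists a, v = 'D_a f u.
Proof.
move=> Uu; have [oU sf _ _ _] := param; split.
  move=> [c cv]; have dc := curve_differentiable cv.
  have [[I [oI I0 sc cL]] [c0 c1]] := cv.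
  have [N [r [oO Op sr rU fr]]] := local_retraction Uu.
  have rp := retraction_paramK Uu rU fr Op.
  have dr : differentiable r (c 0).
    by rewrite c0; exact: smooth_on_differentiable sr Op.
  have df : differentiable f ((r \o c) 0).
    by rewrite /= c0 rp; exact: param_differentiable.
  have cE : \forall t \near (0 : R^o), (f \o (r \o c)) t = c t.
    have oI' : open (I `&` c @^-1` N).
      by apply: open_preimage => // x; exact: smooth_on_continuous sc.
    have I'0 : (I `&` c @^-1` N) 0 by split=> //=; rewrite c0.
    by apply: filterS (near_in oI' I'0) => t [It Ot] /=; apply: fr => //; exact: cL.
  exists (derive1 (r \o c) 0).
  rewrite -c1 derive1E -(near_eq_derive _ cE) -derive1E.
  rewrite derive1_comp_curve //; last exact: differentiable_comp.
  by rewrite /= c0 rp.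
move=> [a ->]; exists (fun t : R^o => f (t *: a + u)).
pose I := [set t : R^o | U (t *: a + u)].
have oI : open I.
  rewrite -[I]setTI; apply: open_preimage oU => [|t _]; first exact: openT.
  by apply: (smooth_on_continuous (smooth_line u a openT)).
have I0 : I 0 by rewrite /I /= scale0r add0r.
split; last split.
- exists I; split=> // [k|t It]; last exact: param_mem.
  exact: (diff_upto_comp_row oI oU _ (smooth_line u a oI k) (sf k)).
- by rewrite scale0r add0r.
- have df : differentiable f ((0 : R^o) *: a + u).
    by rewrite scale0r add0r; exact: param_differentiable.
  by rewrite derive1E (derive_val (is_derive := is_derive_line df)) scale0r add0r.
Qed.

(** [nabla] picks some curve by choice. Its value does not depend on the curve because, along each
    one, it equals the derivative of a smooth local extension of [g]; the default value is excluded
    since the vector is tangent. *)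
Lemma nabla_param W (g : 'rV[R]_m -> W) u a : U u -> smooth_along L g ->
  nabla L g (f u) ('D_a f u) = 'D_a (g \o f) u.
Proof.
move=> Uu sg; have df := param_differentiable Uu.
have [N [F [oO Op sF FE]]] := sg _ (param_mem Uu).
have dF := smooth_on_differentiable sF Op.
have E : 'D_a (g \o f) u = 'D_('D_a f u) F (f u).
  have oU' : open (U `&` f @^-1` N).
    by apply: open_preimage => [|x|//]; [exact: param_open|
      exact: smooth_on_continuous param_smooth].
  rewrite -(@eq_derive_on _ _ _ _ (F \o f) _ _ _ oU') => [|//|x [Ux Nx] /=].
    rewrite deriveE; last exact: differentiable_comp.
    by rewrite diff_comp //= (deriveE _ dF) (deriveE _ df).
  by apply: FE => //; exact: param_mem.
have H c : curve_in L (f u) ('D_a f u) c -> derive1 (g \o c) 0 = 'D_a (g \o f) u.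
  move=> cv; have dc := curve_differentiable cv.
  have [[I [oI I0 sc cL]] [c0 c1]] := cv.
  have cE : \forall t \near (0 : R^o), (F \o c) t = (g \o c) t.
    have oI' : open (I `&` c @^-1` N).
      by apply: open_preimage => // x; exact: smooth_on_continuous sc.
    have I'0 : (I `&` c @^-1` N) 0 by split=> //=; rewrite c0.
    by apply: filterS (near_in oI' I'0) => t [It Ot] /=; apply: FE => //; exact: cL.
  rewrite derive1E -(near_eq_derive _ cE) -derive1E.
  have dFc : differentiable F (c 0) by rewrite c0.
  by rewrite (derive1_comp_curve dc dFc) c0 c1 E.
rewrite /nabla; case: xgetP => [d _ [c cv ->]|]; first exact: H.
have : tangent L (f u) ('D_a f u) by apply/tangentP => //; exists a.
by move=> [c cv] /(_ (derive1 (g \o c) 0)) []; exists c.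
Qed.

Lemma smooth_comp_param k (g : 'rV[R]_m -> 'rV[R]_k) : smooth_along L g ->
  smooth_on U (g \o f).
Proof.
move=> sg j; apply: diff_upto_local => u Uu.
have [N [F [oO Op sF FE]]] := sg _ (param_mem Uu).
have oU' : open (U `&` f @^-1` N).
  by apply: open_preimage => [|x|//]; [exact: param_open|
    exact: smooth_on_continuous param_smooth].
exists (U `&` f @^-1` N); split=> //.
apply: (@eq_diff_upto _ _ _ _ _ (F \o f)) => // [x [Ux Nx]|].
  by apply: FE => //; exact: param_mem.
apply: (diff_upto_comp_row oU' oO _ _ (sF j)); first by move=> x [].
by apply: sub_diff_upto (param_smooth j) => x [].
Qed.

End Charts.

(** * Anti-self-dual forms and quaternions *)

Section Algebra.
Context {R : realType}.

Lemma dotE n (u v : 'rV[R]_n) : dot u v = \sum_i u 0 i * v 0 i.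
Proof. by rewrite /dot mxE; apply: eq_bigr => i _; rewrite mxE. Qed.

Lemma dotC n (u v : 'rV[R]_n) : dot u v = dot v u.
Proof. by rewrite !dotE; apply: eq_bigr => i _; rewrite mulrC. Qed.

Lemma dotDl n (u v w : 'rV[R]_n) : dot (u + v) w = dot u w + dot v w.
Proof. by rewrite /dot mulmxDl mxE. Qed.

Lemma dotZl n k (u w : 'rV[R]_n) : dot (k *: u) w = k * dot u w.
Proof. by rewrite /dot -scalemxAl mxE. Qed.

Lemma dotNl n (u w : 'rV[R]_n) : dot (- u) w = - dot u w.
Proof. by rewrite /dot mulNmx mxE. Qed.

Lemma dotBl n (u v w : 'rV[R]_n) : dot (u - v) w = dot u w - dot v w.
Proof. by rewrite dotDl dotNl. Qed.

Lemma dot0l n (w : 'rV[R]_n) : dot 0 w = 0.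
Proof. by rewrite /dot mul0mx mxE. Qed.

Lemma dotDr n (u v w : 'rV[R]_n) : dot w (u + v) = dot w u + dot w v.
Proof. by rewrite dotC dotDl !(dotC w). Qed.

Lemma dotZr n k (u w : 'rV[R]_n) : dot w (k *: u) = k * dot w u.
Proof. by rewrite dotC dotZl dotC. Qed.

Lemma dotNr n (u w : 'rV[R]_n) : dot w (- u) = - dot w u.
Proof. by rewrite dotC dotNl dotC. Qed.

Lemma dotBr n (u v w : 'rV[R]_n) : dot w (u - v) = dot w u - dot w v.
Proof. by rewrite dotDr dotNr. Qed.

Lemma dot0r n (w : 'rV[R]_n) : dot w 0 = 0.
Proof. by rewrite dotC dot0l. Qed.

Lemma dot_ge0 n (u : 'rV[R]_n) : 0 <= dot u u.
Proof. by rewrite dotE; apply: sumr_ge0 => i _; rewrite -expr2 sqr_ge0. Qed.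

Lemma dot_eq0 n (u : 'rV[R]_n) : (dot u u == 0) = (u == 0).
Proof.
apply/idP/eqP => [|->]; last by rewrite dot0l.
rewrite dotE psumr_eq0 => [/allP H|i _]; last by rewrite -expr2 sqr_ge0.
apply/rowP => i; rewrite mxE; apply/eqP.
by have := H i (mem_index_enum i); rewrite mulf_eq0 orbb.
Qed.

Lemma dot_gt0 n (u : 'rV[R]_n) : u != 0 -> 0 < dot u u.
Proof. by move=> u0; rewrite lt_def dot_eq0 u0 dot_ge0. Qed.

Lemma sum3E (V : nmodType) (F : 'I_3 -> V) : \sum_i F i = F 0 + F 1 + F 2.
Proof.
rewrite !big_ord_recl big_ord0 addr0 addrA.
by congr (F _ + F _ + F _); apply: val_inj.
Qed.

Lemma sum4E (V : nmodType) (F : 'I_4 -> V) : \sum_i F i = F 0 + F 1 + F 2 + F 3.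
Proof.
rewrite !big_ord_recl big_ord0 addr0 !addrA.
by congr (F _ + F _ + F _ + F _); apply: val_inj.
Qed.

Lemma dot3E (u v : 'rV[R]_3) :
  dot u v = u 0 0 * v 0 0 + u 0 1 * v 0 1 + u 0 2 * v 0 2.
Proof. by rewrite dotE sum3E. Qed.

Lemma dot4E (u v : 'rV[R]_4) :
  dot u v = u 0 0 * v 0 0 + u 0 1 * v 0 1 + u 0 2 * v 0 2 + u 0 3 * v 0 3.
Proof. by rewrite dotE sum4E. Qed.

Lemma forall3P (P : 'I_3 -> Prop) : P 0 -> P 1 -> P 2 -> forall i, P i.
Proof.
move=> P0 P1 P2 [[|[|[|//]]] i3].
- by rewrite (_ : Ordinal i3 = 0) //; exact: val_inj.
- by rewrite (_ : Ordinal i3 = 1) //; exact: val_inj.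
- by rewrite (_ : Ordinal i3 = 2) //; exact: val_inj.
Qed.

Lemma forall4P (P : 'I_4 -> Prop) : P 0 -> P 1 -> P 2 -> P 3 -> forall i, P i.
Proof.
move=> P0 P1 P2 P3 [[|[|[|[|//]]]] i4].
- by rewrite (_ : Ordinal i4 = 0) //; exact: val_inj.
- by rewrite (_ : Ordinal i4 = 1) //; exact: val_inj.
- by rewrite (_ : Ordinal i4 = 2) //; exact: val_inj.
- by rewrite (_ : Ordinal i4 = 3) //; exact: val_inj.
Qed.

Definition row3 (x y z : R) : 'rV[R]_3 :=
  \row_k match val k with 0%N => x | 1%N => y | _ => z end.

Definition row4 (x y z t : R) : 'rV[R]_4 :=
  \row_k match val k with 0%N => x | 1%N => y | 2%N => z | _ => t end.

(* With a and b read as quaternions, this is the imaginary part of (conj a) b: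
   the coordinates of the anti-self-dual part of (a /\ b), doubled. *)
Definition asd (a b : 'rV[R]_4) : 'rV[R]_3 :=
  row3 (a 0 0 * b 0 1 - a 0 1 * b 0 0 - (a 0 2 * b 0 3 - a 0 3 * b 0 2))
       (a 0 0 * b 0 2 - a 0 2 * b 0 0 - (a 0 3 * b 0 1 - a 0 1 * b 0 3))
       (a 0 0 * b 0 3 - a 0 3 * b 0 0 - (a 0 1 * b 0 2 - a 0 2 * b 0 1)).

Definition cross (a b : 'rV[R]_3) : 'rV[R]_3 :=
  row3 (a 0 1 * b 0 2 - a 0 2 * b 0 1) (a 0 2 * b 0 0 - a 0 0 * b 0 2)
       (a 0 0 * b 0 1 - a 0 1 * b 0 0).

(* The product of the quaternion a and the imaginary quaternion q. *)
Definition qmul (a : 'rV[R]_4) (q : 'rV[R]_3) : 'rV[R]_4 :=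
  row4 (- (a 0 1 * q 0 0 + a 0 2 * q 0 1 + a 0 3 * q 0 2))
       (a 0 0 * q 0 0 + (a 0 2 * q 0 2 - a 0 3 * q 0 1))
       (a 0 0 * q 0 1 + (a 0 3 * q 0 0 - a 0 1 * q 0 2))
       (a 0 0 * q 0 2 + (a 0 1 * q 0 1 - a 0 2 * q 0 0)).

(** Laplace expansion along the first two rows: the determinant as the wedge product of two
    bivectors. *)
Definition det4 (a b c d : 'rV[R]_4) : R :=
  let m i j := a 0 i * b 0 j - a 0 j * b 0 i in
  let m' i j := c 0 i * d 0 j - c 0 j * d 0 i in
  m 0 1 * m' 2 3 - m 0 2 * m' 1 3 + m 0 3 * m' 1 2
  + m 1 2 * m' 0 3 - m 1 3 * m' 0 2 + m 2 3 * m' 0 1.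

Lemma row3E x y z :
  ((row3 x y z 0 0 = x) * (row3 x y z 0 1 = y) * (row3 x y z 0 2 = z))%type.
Proof. by rewrite /row3 !mxE. Qed.

Lemma row4E x y z t :
  ((row4 x y z t 0 0 = x) * (row4 x y z t 0 1 = y) *
   (row4 x y z t 0 2 = z) * (row4 x y z t 0 3 = t))%type.
Proof. by rewrite /row4 !mxE. Qed.

Local Ltac coords :=
  rewrite ?dot4E ?dot3E /det4 /asd /qmul /cross ?(row3E, row4E, mxE); ring.
Local Ltac coords3 := apply/rowP; apply: forall3P; coords.
Local Ltac coords4 := apply/rowP; apply: forall4P; coords.

Lemma asdC a b : asd b a = - asd a b. Proof. by coords3. Qed.
Lemma asdDl a b c : asd (a + b) c = asd a c + asd b c. Proof. by coords3. Qed.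
Lemma asdZl k a c : asd (k *: a) c = k *: asd a c. Proof. by coords3. Qed.
Lemma asdDr a b c : asd c (a + b) = asd c a + asd c b. Proof. by coords3. Qed.
Lemma asdZr k a c : asd c (k *: a) = k *: asd c a. Proof. by coords3. Qed.
Lemma asdxx a : asd a a = 0. Proof. by coords3. Qed.

Lemma crossDl a b c : cross (a + b) c = cross a c + cross b c.
Proof. by coords3. Qed.
Lemma crossDr a b c : cross c (a + b) = cross c a + cross c b.
Proof. by coords3. Qed.
Lemma crossZl k a c : cross (k *: a) c = k *: cross a c. Proof. by coords3. Qed.
Lemma crossZr k a c : cross c (k *: a) = k *: cross c a. Proof. by coords3. Qed.

Lemma cross0l a : cross 0 a = 0. Proof. by coords3. Qed.
Lemma cross0r a : cross a 0 = 0. Proof. by coords3. Qed.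
Lemma asd0l a : asd 0 a = 0. Proof. by coords3. Qed.
Lemma asd0r a : asd a 0 = 0. Proof. by coords3. Qed.

Lemma dot_crossl a b : dot (cross a b) a = 0. Proof. by coords. Qed.
Lemma dot_crossr a b : dot (cross a b) b = 0. Proof. by coords. Qed.
Lemma dot_cross_rot a b c : dot (cross a b) c = dot (cross b c) a.
Proof. by coords. Qed.

Lemma cross_cross a b c : cross a (cross b c) = dot a c *: b - dot a b *: c.
Proof. by coords3. Qed.

Lemma cross_cross_dot w a b :
  cross (cross w a) (cross w b) = dot (cross w a) b *: w.
Proof. by coords3. Qed.

(** The Gram determinant is the inner product of the two bivectors and [det4] their wedge product;
    projecting to the anti-self-dual part subtracts the second from the first. *)
Lemma dot_asd_asd a b c d : dot (asd a b) (asd c d) =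
  dot a c * dot b d - dot a d * dot b c - det4 a b c d.
Proof. by coords. Qed.

Lemma dot_asd_common a b c : dot (asd a b) (asd a c) =
  dot a a * dot b c - dot a b * dot a c.
Proof. by coords. Qed.

Lemma det2E (M : 'M[R]_2) : \det M = M 0 0 * M 1 1 - M 0 1 * M 1 0.
Proof.
rewrite (expand_det_row _ 0) !big_ord_recl big_ord0 /cofactor !det_mx11 !mxE /= addr0.
rewrite /bump /= !expr0 !expr1 !mul1r mulN1r mulrN.
by congr (_ * M _ _ - M _ _ * M _ _); apply: val_inj.
Qed.

Lemma det3E (M : 'M[R]_3) : \det M =
  M 0 0 * (M 1 1 * M 2 2 - M 1 2 * M 2 1)
  - M 0 1 * (M 1 0 * M 2 2 - M 1 2 * M 2 0)
  + M 0 2 * (M 1 0 * M 2 1 - M 1 1 * M 2 0).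
Proof.
rewrite (expand_det_row _ 0) !big_ord_recl big_ord0 /cofactor !det2E !mxE /= addr0.
rewrite /bump /= !expr0 !expr1 !mul1r mulN1r mulrN [(-1) ^+ _]mulrNN !mul1r addrA.
by congr (_ * (M _ _ * M _ _ - M _ _ * M _ _)
  - M _ _ * (M _ _ * M _ _ - M _ _ * M _ _)
  + M _ _ * (M _ _ * M _ _ - M _ _ * M _ _)); apply: val_inj.
Qed.

Lemma det4E (e : 'M[R]_4) :
  \det e = det4 (row 0 e) (row 1 e) (row 2 e) (row 3 e).
Proof.
have l00 : lift (0 : 'I_4) (0 : 'I_3) = 1 by exact: val_inj.
have l01 : lift (0 : 'I_4) (1 : 'I_3) = 2 by exact: val_inj.
have l02 : lift (0 : 'I_4) (2 : 'I_3) = 3 by exact: val_inj.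
have l10 : lift (1 : 'I_4) (0 : 'I_3) = 0 by exact: val_inj.
have l11 : lift (1 : 'I_4) (1 : 'I_3) = 2 by exact: val_inj.
have l12 : lift (1 : 'I_4) (2 : 'I_3) = 3 by exact: val_inj.
have l20 : lift (2 : 'I_4) (0 : 'I_3) = 0 by exact: val_inj.
have l21 : lift (2 : 'I_4) (1 : 'I_3) = 1 by exact: val_inj.
have l22 : lift (2 : 'I_4) (2 : 'I_3) = 3 by exact: val_inj.
have l30 : lift (3 : 'I_4) (0 : 'I_3) = 0 by exact: val_inj.
have l31 : lift (3 : 'I_4) (1 : 'I_3) = 1 by exact: val_inj.
have l32 : lift (3 : 'I_4) (2 : 'I_3) = 2 by exact: val_inj.
rewrite (expand_det_row _ 0) sum4E /cofactor !det3E !mxE.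
rewrite !(l00, l01, l02, l10, l11, l12, l20, l21, l22, l30, l31, l32) /=.
rewrite /det4 !mxE; ring.
Qed.

Lemma dot_qmul a q q' : dot (qmul a q) (qmul a q') = dot a a * dot q q'.
Proof. by coords. Qed.

Lemma dot_qmul0 a q : dot a (qmul a q) = 0. Proof. by coords. Qed.

(** In quaternions [conj a * b = dot a b + asd a b]; multiply by [a] on the left. Hence a vanishing
    [asd a b] forces a linear relation between [a] and [b]. *)
Lemma qmul_asd a b : qmul a (asd a b) = dot a a *: b - dot a b *: a.
Proof. by coords4. Qed.

Lemma det4_qmul a w q : det4 a (qmul a w) (qmul a q) (qmul a (cross w q)) =
  dot a a ^+ 2 * (dot w w * dot q q - dot w q ^+ 2).
Proof. by coords. Qed.

End Algebra.

(** * Oriented orthonormal frames of R^4 *)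

Section Frames.
Context {R : realType}.

Local Ltac coords :=
  rewrite ?dot4E ?dot3E /det4 /asd /qmul /cross ?(row3E, row4E, mxE); ring.

Lemma asd_formE (c : 'rV[R]_3) u v : asd_form c u v = dot c (asd u v).
Proof.
rewrite /asd_form sum3E dot3E /omega /wedge /std_coframe /asd !row3E /=.
ring.
Qed.

(** The vertical volume form is a triple product, and the forms [omega] on horizontal parts are the
    coordinates of [asd]. *)
Lemma phiE (u v w : Defs.total R) : phi u v w =
  dot (cross u.2 v.2) w.2 + dot u.2 (asd v.1 w.1) + dot v.2 (asd w.1 u.1)
  + dot w.2 (asd u.1 v.1).
Proof.
rewrite /phi sum3E /wedge12 /omega /wedge /ebar /omcheck /=.
rewrite ?dot4E ?dot3E /det4 /asd /qmul /cross ?(row3E, row4E, mxE). ring.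
Qed.

Section Frame.
Variable e : 'M[R]_4.
Hypotheses (e_orth : e *m e^T = 1%:M) (e_det : \det e = 1).

Lemma frame_dot i j : dot (row i e) (row j e) = (i == j)%:R.
Proof.
have := congr1 (fun M : 'M[R]_4 => M i j) e_orth; rewrite !mxE => <-.
by rewrite dotE; apply: eq_bigr => k _; rewrite !mxE.
Qed.

Lemma frame_expand (u : 'rV[R]_4) : u = \sum_i dot (row i e) u *: row i e.
Proof.
rewrite -[LHS]mulmx1 -(mulmx1C e_orth) mulmxA [LHS]mulmx_sum_row.
apply: eq_bigr => i _; congr (_ *: _).
by rewrite dotC dotE mxE; apply: eq_bigr => k _; rewrite !mxE.
Qed.

Let det4e : det4 (row 0 e) (row 1 e) (row 2 e) (row 3 e) = 1.
Proof. by rewrite -det4E. Qed.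

(** The squared norm of the difference of the two sides is a combination of Gram determinants and
    values of [det4], all known in an oriented orthonormal frame, and it comes out as 0. The same
    argument gives the next two relations. *)
Lemma frame_asd23 : asd (row 2 e) (row 3 e) = - asd (row 0 e) (row 1 e).
Proof.
apply/eqP; rewrite -subr_eq0 opprK -dot_eq0; apply/eqP.
rewrite !dotDl !dotDr !dot_asd_asd !frame_dot /=.
have -> : det4 (row 2 e) (row 3 e) (row 0 e) (row 1 e) = 1.
  by rewrite -det4e /det4; ring.
have -> : det4 (row 0 e) (row 1 e) (row 0 e) (row 1 e) = 0 by rewrite /det4; ring.
have -> : det4 (row 2 e) (row 3 e) (row 2 e) (row 3 e) = 0 by rewrite /det4; ring.
by rewrite det4e; ring.
Qed.

Lemma frame_asd13 : asd (row 1 e) (row 3 e) = asd (row 0 e) (row 2 e).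
Proof.
apply/eqP; rewrite -subr_eq0 -dot_eq0; apply/eqP.
rewrite !dotBl !dotBr !dot_asd_asd !frame_dot /=.
have -> : det4 (row 1 e) (row 3 e) (row 0 e) (row 2 e) = -1.
  by rewrite -det4e /det4; ring.
have -> : det4 (row 0 e) (row 2 e) (row 1 e) (row 3 e) = -1.
  by rewrite -det4e /det4; ring.
have -> : det4 (row 0 e) (row 2 e) (row 0 e) (row 2 e) = 0 by rewrite /det4; ring.
have -> : det4 (row 1 e) (row 3 e) (row 1 e) (row 3 e) = 0 by rewrite /det4; ring.
by ring.
Qed.

Lemma frame_asd12 : asd (row 1 e) (row 2 e) = - asd (row 0 e) (row 3 e).
Proof.
apply/eqP; rewrite -subr_eq0 opprK -dot_eq0; apply/eqP.
rewrite !dotDl !dotDr !dot_asd_asd !frame_dot /=.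
have -> : det4 (row 1 e) (row 2 e) (row 0 e) (row 3 e) = 1.
  by rewrite -det4e /det4; ring.
have -> : det4 (row 0 e) (row 3 e) (row 1 e) (row 2 e) = 1.
  by rewrite -det4e /det4; ring.
have -> : det4 (row 0 e) (row 3 e) (row 0 e) (row 3 e) = 0 by rewrite /det4; ring.
have -> : det4 (row 1 e) (row 2 e) (row 1 e) (row 2 e) = 0 by rewrite /det4; ring.
by ring.
Qed.

Lemma frame_asd_dot i j : (i != 0) -> (j != 0) ->
  dot (asd (row 0 e) (row i e)) (asd (row 0 e) (row j e)) = (i == j)%:R.
Proof.
move=> i0 j0; rewrite dot_asd_common !frame_dot eqxx.
by rewrite [0 == i]eq_sym (negPf i0) mul0r subr0 mul1r.
Qed.

(** The relations above reduce the six bivectors of the frame to three. This links the [omega] of an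
    arbitrary adapted coframe to the fixed coordinates of the fibre. *)
Lemma asd_frame u v : asd u v =
  omega (coframe e) 0 u v *: asd (row 0 e) (row 1 e)
  + omega (coframe e) 1 u v *: asd (row 0 e) (row 2 e)
  + omega (coframe e) 2 u v *: asd (row 0 e) (row 3 e).
Proof.
rewrite [in LHS](frame_expand u) [in LHS](frame_expand v) !sum4E.
rewrite !asdDl !asdDr !asdZl !asdZr !asdxx.
rewrite (asdC (row 0 e) (row 1 e)) (asdC (row 0 e) (row 2 e)).
rewrite (asdC (row 0 e) (row 3 e)) (asdC (row 1 e) (row 2 e)).
rewrite (asdC (row 1 e) (row 3 e)) (asdC (row 2 e) (row 3 e)).
rewrite frame_asd23 frame_asd13 frame_asd12 /omega /wedge /coframe /=.
move: (asd _ (row 1 e)) (asd _ (row 2 e)) (asd _ (row 3 e)) => w1 w2 w3.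
by apply/rowP => k; rewrite !mxE; ring.
Qed.

End Frame.

Lemma cross_neq0 (w : 'rV[R]_3) : w != 0 -> exists x, cross w x != 0.
Proof.
move=> /eqP w0; apply: contrapT => H; apply: w0.
have cw x : cross w x = 0.
  by apply/eqP/negPn/negP => cx; apply: H; exists x.
have /rowP E1 := cw (row3 1 0 0); have /rowP E2 := cw (row3 0 1 0).
have := E1 1; have := E1 2; have := E2 2.
rewrite /cross !(row3E, mxE) => e1 e2 e3.
by apply/rowP; apply: forall3P; rewrite mxE; move: e1 e2 e3; lra.
Qed.

Lemma exists_unit_orthogonal (w : 'rV[R]_3) : w != 0 ->
  exists q, dot q q = 1 /\ dot w q = 0.
Proof.
move=> /cross_neq0[x cx0].
pose s := Num.sqrt (dot (cross w x) (cross w x)).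
have s0 : s != 0 by rewrite sqrtr_eq0 -ltNge dot_gt0.
exists (s^-1 *: cross w x); split; last first.
  by rewrite dotZr dotC dot_crossl mulr0.
rewrite dotZl dotZr mulrA -[X in _ * X](@sqr_sqrtr _ (dot _ _)) ?dot_ge0 //.
by rewrite -/s; field.
Qed.

(** For a unit [a], left multiplication by [a] is an orientation-preserving isometry that sends
    [w = asd a b] to [b]. So [1, w, q, cross w q], with [q] a unit imaginary quaternion orthogonal
    to [w], is carried to the required frame. *)
Lemma frame_completion (a b : 'rV[R]_4) :
  dot a a = 1 -> dot b b = 1 -> dot a b = 0 ->
  exists e : 'M[R]_4, [/\ e *m e^T = 1%:M, \det e = 1, row 0 e = a & row 1 e = b].
Proof.
move=> a1 b1 ab0; pose w := asd a b.
have w1 : dot w w = 1 by rewrite dot_asd_common a1 b1 ab0; ring.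
have wb : qmul a w = b by rewrite qmul_asd a1 ab0 scale1r scale0r subr0.
have [|q [q1 wq0]] := @exists_unit_orthogonal w.
  by rewrite -dot_eq0 w1 oner_neq0.
pose rows (i : 'I_4) := match val i with
  | 0%N => a | 1%N => qmul a w | 2%N => qmul a q | _ => qmul a (cross w q) end.
pose e := \matrix_(i < 4) rows i.
have r0 : row 0 e = a by rewrite rowK.
have r1 : row 1 e = qmul a w by rewrite rowK.
have r2 : row 2 e = qmul a q by rewrite rowK.
have r3 : row 3 e = qmul a (cross w q) by rewrite rowK.
exists e; rewrite r0 r1; split=> //; last first.
  by rewrite det4E r0 r1 r2 r3 det4_qmul a1 w1 q1 wq0; ring.
have c1 : dot (cross w q) (cross w q) = 1.
  have -> : dot (cross w q) (cross w q) = dot w w * dot q q - dot w q ^+ 2 by coords.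
  by rewrite w1 q1 wq0; ring.
have cw0 : dot w (cross w q) = 0 by rewrite dotC dot_crossl.
have cq0 : dot q (cross w q) = 0 by rewrite dotC dot_crossr.
have E i j : (e *m e^T) i j = dot (row i e) (row j e).
  by rewrite mxE dotE; apply: eq_bigr => k _; rewrite !mxE.
apply/matrixP => i j; rewrite E mxE; move: i j.
apply: forall4P; apply: forall4P;
  rewrite ?(r0, r1, r2, r3) ?dot_qmul0 ?(dotC _ a) ?dot_qmul0 ?dot_qmul //= ?a1
    ?w1 ?q1 ?c1 ?wq0 ?cw0 ?cq0 ?(dotC q w) ?(dotC _ w) ?wq0 ?cw0 ?(dotC _ q)
    ?cq0 ?mulr0 ?mulr1 //.
Qed.

End Frames.

(** * Product rule for bilinear maps, to be used for [dot], [asd] and [cross] *)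

Section BilinearCalculus.
Context {R : realType}.
Implicit Types V W : normedModType R.

Lemma derive_comp V V' W (f : V -> V') (g : V' -> W) x v :
  differentiable f x -> differentiable g (f x) ->
  'D_v (g \o f) x = 'D_('D_v f x) g (f x).
Proof.
move=> df dg; rewrite deriveE; last exact: differentiable_comp.
by rewrite diff_comp //= (deriveE _ dg) (deriveE _ df).
Qed.

Lemma deriveDZ V W (f : V -> W) x a b k l : differentiable f x ->
  'D_(k *: a + l *: b) f x = k *: 'D_a f x + l *: 'D_b f x.
Proof. by move=> df; rewrite !deriveE // linearD !linearZ. Qed.

Lemma derive_pair V W W' (f : V -> W) (g : V -> W') x v :
  differentiable f x -> differentiable g x ->
  'D_v (fun y => (f y, g y) : W * W')%type x = ('D_v f x, 'D_v g x).
Proof.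
move=> df dg; rewrite deriveE; last exact: differentiable_pair.
by rewrite diff_pair //= (deriveE _ df) (deriveE _ dg).
Qed.

Lemma derive_scalel V W (s : V -> R^o) (w : W) x v : differentiable s x ->
  'D_v (fun y => s y *: w) x = 'D_v s x *: w.
Proof.
move=> ds; rewrite deriveE; last exact: differentiableZl.
by rewrite diffZl // (deriveE _ ds).
Qed.

Lemma diff_upto_scalel V W k (U : set V) (s : V -> R^o) (w : W) : open U ->
  diff_upto k U s -> diff_upto k U (fun x => s x *: w).
Proof.
move=> oU; elim: k s => // k IH s [ds Ds]; split=> [x Ux|v].
  by apply: differentiableZl; exact: ds.
apply: (eq_diff_upto oU _ (IH _ (Ds v))) => x Ux.
by rewrite derive_scalel //; exact: ds.
Qed.

Section Bilinear.
Variables (n m : nat) (W : normedModType R) (B : 'rV[R]_n -> 'rV[R]_m -> W).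
Hypotheses (BDl : forall a b c, B (a + b) c = B a c + B b c)
  (BZl : forall k a c, B (k *: a) c = k *: B a c)
  (BDr : forall a b c, B c (a + b) = B c a + B c b)
  (BZr : forall k a c, B c (k *: a) = k *: B c a).

Let bilin_expand a b : B a b =
  \sum_i \sum_j (a 0 i * b 0 j) *: B (delta_mx 0 i) (delta_mx 0 j).
Proof.
have B0l c : B 0 c = 0 by rewrite -(scale0r (0 : 'rV[R]_n)) BZl scale0r.
have B0r c : B c 0 = 0 by rewrite -(scale0r (0 : 'rV[R]_m)) BZr scale0r.
rewrite [in LHS](row_sum_delta a).
rewrite (big_morph (B^~ b) (fun x y => BDl x y b) (B0l b)).
apply: eq_bigr => i _; rewrite BZl [in LHS](row_sum_delta b).
rewrite (big_morph (B (delta_mx 0 i)) (fun x y => BDr x y _) (B0r _)) scaler_sumr.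
by apply: eq_bigr => j _; rewrite BZr scalerA.
Qed.

Lemma diff_upto_bilin V k (U : set V) (a : V -> 'rV[R]_n) (b : V -> 'rV[R]_m) :
  open U -> diff_upto k U a -> diff_upto k U b ->
  diff_upto k U (fun x => B (a x) (b x)).
Proof.
move=> oU da db.
have H i : diff_upto k U (fun x => \sum_j (a x 0 i * b x 0 j) *:
    B (delta_mx 0 i) (delta_mx 0 j)).
  apply: diff_upto_sum => // j; apply: diff_upto_scalel => //.
  apply: diff_uptoM => //; first exact: ((diff_upto_rowP k a oU).1 da).
  exact: ((diff_upto_rowP k b oU).1 db).
by apply: (eq_diff_upto oU _ (diff_upto_sum oU H)) => x _; rewrite bilin_expand.
Qed.

Lemma differentiable_bilin_comp V (a : V -> 'rV[R]_n) (b : V -> 'rV[R]_m) x :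
  differentiable a x -> differentiable b x ->
  differentiable (fun x => B (a x) (b x)) x.
Proof.
move=> da db.
rewrite (_ : (fun x => _) = \sum_i \sum_j (fun x =>
    (a x 0 i * b x 0 j) *: B (delta_mx 0 i) (delta_mx 0 j))); last first.
  apply/funext => y; rewrite bilin_expand fct_sumE.
  by apply: eq_bigr => i _; rewrite fct_sumE.
apply: differentiable_sum => i; apply: differentiable_sum => j.
apply: differentiableZl; apply: differentiableM; exact: differentiable_entry.
Qed.

Lemma derive_bilin V (a : V -> 'rV[R]_n) (b : V -> 'rV[R]_m) x v :
  differentiable a x -> differentiable b x ->
  'D_v (fun x => B (a x) (b x)) x = B ('D_v a x) (b x) + B (a x) ('D_v b x).
Proof.
move=> da db.
pose t i j := fun x => (a x 0 i * b x 0 j) *: B (delta_mx 0 i) (delta_mx 0 j).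
have dt i j : differentiable (t i j) x.
  by apply: differentiableZl; apply: differentiableM; exact: differentiable_entry.
rewrite (_ : (fun x => _) = \sum_i \sum_j t i j); last first.
  apply/funext => y; rewrite bilin_expand fct_sumE.
  by apply: eq_bigr => i _; rewrite fct_sumE.
rewrite derive_sum => [|i]; last first.
  by apply: diff_derivable; apply: differentiable_sum.
rewrite [B ('D_v a x) _]bilin_expand [B _ ('D_v b x)]bilin_expand -big_split /=.
apply: eq_bigr => i _; rewrite derive_sum => [|j]; last exact: diff_derivable.
rewrite -big_split /=; apply: eq_bigr => j _.
have da' := differentiable_entry i da; have db' := differentiable_entry j db.
rewrite /t derive_scalel; last exact: differentiableM.
rewrite deriveM; [|exact: diff_derivable|exact: diff_derivable].
rewrite derive_coord // derive_coord // -scalerDl; congr (_ *: _).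
by rewrite addrC /GRing.scale /= [X in X + _]mulrC.
Qed.

End Bilinear.
End BilinearCalculus.

(** * Geometry of a chart of the surface *)

Section OrthogonalProjection.
Context {R : realType} (n : nat).
Implicit Types (S : set 'rV[R]_n) (u v w : 'rV[R]_n).

(** Two candidates differ by an element of [S] that is orthogonal to [S]. This identifies the value
    chosen in [orthproj] and rules out its default. *)
Lemma orthproj_unique S v u :
  (forall k a b, S a -> S b -> S (k *: a + b)) ->
  S u -> (forall w, S w -> dot (v - u) w = 0) -> orthproj S v = u.
Proof.
move=> Slin Su uP; rewrite /orthproj.
case: xgetP => [u' _ [Su' u'P]|/(_ u)[]]; last by split.
have Sd : S (u' - u) by rewrite addrC -scaleN1r; exact: Slin.
apply/eqP; rewrite -subr_eq0 -dot_eq0; apply/eqP.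
have -> : dot (u' - u) (u' - u) = dot (v - u) (u' - u) - dot (v - u') (u' - u).
  by rewrite -dotBl opprB [v - u + _]addrC subrKA.
by rewrite uP // u'P // subrr.
Qed.

End OrthogonalProjection.

Section SurfaceGeometry.
Context {R : realType}.
Implicit Types (f : 'rV[R]_2 -> 'rV[R]_4) (U : set 'rV[R]_2).

Definition e0 : 'rV[R]_2 := delta_mx 0 0.
Definition e1 : 'rV[R]_2 := delta_mx 0 1.

Definition chart_asd f u : 'rV[R]_3 := asd ('D_e0 f u) ('D_e1 f u).

Definition minor2 (a b : 'rV[R]_2) : R := a 0 0 * b 0 1 - a 0 1 * b 0 0.

Lemma forall2P (P : 'I_2 -> Prop) : P 0 -> P 1 -> forall i, P i.
Proof.
move=> P0 P1 [[|[|//]] i2].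
- by rewrite (_ : Ordinal i2 = 0) //; exact: val_inj.
- by rewrite (_ : Ordinal i2 = 1) //; exact: val_inj.
Qed.

Lemma row2_expand (a : 'rV[R]_2) : a = a 0 0 *: e0 + a 0 1 *: e1.
Proof.
rewrite [LHS]row_sum_delta big_ord_recl big_ord1; congr (_ + _ *: delta_mx _ _).
  by congr (a 0 _); apply: val_inj.
exact: val_inj.
Qed.

Lemma derive_row2 f u a : differentiable f u ->
  'D_a f u = a 0 0 *: 'D_e0 f u + a 0 1 *: 'D_e1 f u.
Proof.
by move=> df; rewrite [X in 'D_X _ _ = _](row2_expand a) (deriveDZ _ _ _ _ df).
Qed.

Lemma asd_derive f u a b : differentiable f u ->
  asd ('D_a f u) ('D_b f u) = minor2 a b *: chart_asd f u.
Proof.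
move=> df; rewrite (derive_row2 a df) (derive_row2 b df).
rewrite /chart_asd; move: ('D_e0 f u) ('D_e1 f u) => x y.
rewrite !asdDl !asdDr !asdZl !asdZr !asdxx (asdC x y) /minor2.
by apply/rowP => k; rewrite !mxE; ring.
Qed.

Lemma minor2_span (a b c : 'rV[R]_2) : minor2 a b != 0 ->
  c = (minor2 c b / minor2 a b) *: a + (minor2 a c / minor2 a b) *: b.
Proof.
move=> ab0.
have E : minor2 a b *: c = minor2 c b *: a + minor2 a c *: b.
  by apply/rowP; apply: forall2P; rewrite !mxE /minor2; ring.
apply: (scalerI ab0); rewrite E scalerDr !scalerA.
by rewrite ![minor2 a b * _]mulrC !divfK.
Qed.

Section Chart.
Variables (L : oriented_surface R) (U : set 'rV[R]_2)
  (f : 'rV[R]_2 -> 'rV[R]_4).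
Hypothesis chart : os_charts L U f.

Let param : local_param L U f := os_param chart.

Lemma chart_open : open U. Proof. exact: param_open param. Qed.

Lemma chart_smooth : smooth_on U f. Proof. exact: param_smooth param. Qed.

Lemma chart_differentiable u : U u -> differentiable f u.
Proof. exact: param_differentiable param u. Qed.

Lemma chart_derive_inj u a : U u -> 'D_a f u = 0 -> a = 0.
Proof.
move=> Uu; rewrite deriveE; last exact: chart_differentiable.
have [_ _ _ dinj _] := param.
by move=> a0; apply: (dinj _ Uu); rewrite linear0.
Qed.

(** If [asd x y] vanished, [qmul_asd] would put [- dot x y *: e0 + dot x x *: e1] into the kernel of
    the injective differential; then [dot x x = 0], so [e0] would lie in it too. *)
Lemma chart_asd_neq0 u : U u -> chart_asd f u != 0.
Proof.
move=> Uu; apply/eqP => W0; have df := chart_differentiable Uu.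
set x := 'D_e0 f u; set y := 'D_e1 f u.
have /(chart_derive_inj Uu) : 'D_((- dot x y) *: e0 + dot x x *: e1) f u = 0.
  rewrite (deriveDZ _ _ _ _ df) -/x -/y scaleNr addrC -qmul_asd.
  rewrite -[asd x y]/(chart_asd f u) W0 /qmul; apply/rowP.
  by apply: forall4P; rewrite !(row4E, mxE); ring.
move=> /rowP/(_ 1); rewrite !mxE /= mulr0 add0r mulr1 => /eqP.
rewrite dot_eq0 => /eqP /(chart_derive_inj Uu) /rowP/(_ 0).
by rewrite !mxE /= => /eqP; rewrite oner_eq0.
Qed.

Lemma smooth_chart_asd : smooth_on U (chart_asd f).
Proof.
have oU := chart_open.
move=> k; have [_ Df] := chart_smooth k.+1.
exact: (diff_upto_bilin asdDl asdZl asdDr asdZr oU (Df e0) (Df e1)).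
Qed.

Lemma chart_tangentP u v : U u -> tangent L (f u) v <-> exists a, v = 'D_a f u.
Proof. exact: (tangentP param). Qed.

Lemma oriented_basis_tangent p a b : oriented_basis L p a b ->
  tangent L p a /\ tangent L p b.
Proof.
move=> [V [g [v [Vg Vv <- [J [_ -> ->]]]]]].
have dg := param_differentiable (os_param Vg) Vv.
by split; apply/(tangentP (os_param Vg)) => //; rewrite -deriveE //; eexists.
Qed.

(** A vanishing minor would make [asd (row 0 e) (row 1 e)] vanish, but this vector has norm 1. *)
Lemma adapted_chart u e : U u -> adapted L (f u) e ->
  exists a0 a1, [/\ row 0 e = 'D_a0 f u, row 1 e = 'D_a1 f u & minor2 a0 a1 != 0].
Proof.
move=> Uu [eo ed /oriented_basis_tangent[]].
move=> /(chart_tangentP _ Uu)[a0 E0] /(chart_tangentP _ Uu)[a1 E1].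
exists a0, a1; split=> //; apply/eqP => m0.
have := frame_asd_dot eo (i := 1) (j := 1) isT isT.
rewrite E0 E1 asd_derive; last exact: chart_differentiable.
by rewrite m0 scale0r dot0l => /esym/eqP; rewrite oner_eq0.
Qed.

Lemma adapted_exists u : U u -> exists e, adapted L (f u) e.
Proof.
move=> Uu; have df := chart_differentiable Uu.
set x := 'D_e0 f u; set y := 'D_e1 f u.
have W0 := chart_asd_neq0 Uu.
have xx0 : 0 < dot x x.
  rewrite dot_gt0 //; apply/eqP => x0; move/eqP: W0; apply.
  rewrite /chart_asd -/x x0; apply/rowP.
  by apply: forall3P; rewrite /asd !(row3E, mxE); ring.
pose z := y - (dot x y / dot x x) *: x.
have xz : dot x z = 0 by rewrite /z dotBr dotZr divfK ?subrr // gt_eqF.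
have zz0 : 0 < dot z z.
  rewrite dot_gt0 //; apply/eqP => z0; move/eqP: W0; apply.
  have asdB (x' y' : 'rV[R]_4) k : asd x' y' = asd x' (y' - k *: x').
    by rewrite asdDr -scaleNr asdZr asdxx scaler0 addr0.
  have -> : chart_asd f u = asd x z by exact: asdB.
  by rewrite z0 asdC; apply/rowP; apply: forall3P; rewrite /asd !(row3E, mxE); ring.
pose s := Num.sqrt (dot x x); pose t := Num.sqrt (dot z z).
have s0 : 0 < s by rewrite sqrtr_gt0.
have t0 : 0 < t by rewrite sqrtr_gt0.
have ss : s * s = dot x x by rewrite -expr2 sqr_sqrtr // ltW.
have tt : t * t = dot z z by rewrite -expr2 sqr_sqrtr // ltW.
have s0' := lt0r_neq0 s0; have t0' := lt0r_neq0 t0.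
have [|||e [eo ed r0 r1]] := @frame_completion _ (s^-1 *: x) (t^-1 *: z).
- by rewrite dotZl dotZr -ss; field.
- by rewrite dotZl dotZr -tt; field.
- by rewrite dotZl dotZr xz !mulr0.
exists e; split=> //; exists U, f, u; split=> //.
(* Gram-Schmidt in the coordinate frame: the transition matrix is triangular with diagonal [s^-1],
   [t^-1], hence positively oriented. *)
pose a0 : 'rV[R]_2 := s^-1 *: e0.
pose a1 : 'rV[R]_2 := (- (t^-1 * (dot x y / dot x x))) *: e0 + t^-1 *: e1.
pose J : 'M[R]_2 := \matrix_(i < 2) if i == 0 then a0 else a1.
have J0 : row 0 J = a0 by rewrite rowK.
have J1 : row 1 J = a1 by rewrite rowK.
exists J; rewrite J0 J1; split.
- have JE i j : J i j = (if i == 0 then a0 else a1) 0 j by rewrite mxE.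
  rewrite det2E !JE /= /a0 /a1 !mxE /=.
  rewrite !(mulr0, mulr1, addr0, add0r, mul0r, subr0).
  by rewrite mulr_gt0 // invr_gt0.
- by rewrite -deriveE // r0 -[a0]addr0 -(scale0r e1) (deriveDZ _ _ _ _ df) scale0r addr0.
- rewrite -deriveE // r1 (deriveDZ _ _ _ _ df) -/x -/y /z scalerBr scalerA scaleNr.
  by rewrite addrC.
Qed.

Lemma ElineP p c : Eline L p c <->
  exists e, adapted L p e /\ exists a, c = a *: asd (row 0 e) (row 1 e).
Proof.
split=> [[e [ae [a H]]]|[e [ae [a ->]]]]; exists e; split=> //; exists a.
  have [eo ed _] := ae.
  have {}H u v : dot c (asd u v) = a * dot (asd (row 0 e) (row 1 e)) (asd u v).
    rewrite -asd_formE H (asd_frame eo ed u v) !dotDr !dotZr.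
    by rewrite !(frame_asd_dot eo) //= mulr1 !mulr0 !addr0.
  (* The products of 1 with the three imaginary units have as [asd] the standard basis, so an
     equality of forms is one of coordinate vectors. *)
  have D k : exists u v : 'rV[R]_4, asd u v = delta_mx 0 k.
    move: k; apply: forall3P.
    - exists (row4 1 0 0 0), (row4 0 1 0 0); apply/rowP.
      by apply: forall3P; rewrite /asd !(row3E, row4E, mxE) /=; ring.
    - exists (row4 1 0 0 0), (row4 0 0 1 0); apply/rowP.
      by apply: forall3P; rewrite /asd !(row3E, row4E, mxE) /=; ring.
    - exists (row4 1 0 0 0), (row4 0 0 0 1); apply/rowP.
      by apply: forall3P; rewrite /asd !(row3E, row4E, mxE) /=; ring.
  have dotD (w : 'rV[R]_3) k : dot w (delta_mx 0 k) = w 0 k.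
    rewrite dotE (bigD1 k) //= big1 ?addr0 => [|i ik]; first by rewrite mxE !eqxx mulr1.
    by rewrite mxE (negPf ik) mulr0.
  apply/rowP => k; have [u [v E]] := D k.
  by rewrite -[LHS]dotD -E H E dotD [RHS]mxE.
have [eo ed _] := ae => u v.
rewrite asd_formE (asd_frame eo ed u v) !dotDr !dotZr !dotZl.
by rewrite !(frame_asd_dot eo) //= !mulr0 !addr0 mulr1 mulrC.
Qed.

(** [asd] of any two tangent vectors is a multiple of [chart_asd], which makes the line independent
    of the adapted frame. *)
Lemma chart_ElineP u c : U u ->
  Eline L (f u) c <-> exists a, c = a *: chart_asd f u.
Proof.
move=> Uu; have df := chart_differentiable Uu; split.
  move=> /ElineP[e [/(adapted_chart Uu)[a0 [a1 [-> -> _]]] [a ->]]].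
  rewrite (asd_derive _ _ df) scalerA; by eexists.
move=> [a ->]; have [e ae] := adapted_exists Uu.
have [a0 [a1 [E0 E1 m0]]] := adapted_chart Uu ae.
apply/ElineP; exists e; split=> //; exists (a / minor2 a0 a1).
by rewrite E0 E1 asd_derive // scalerA divfK.
Qed.

Lemma chart_FplaneP u s : U u -> Fplane L (f u) s <-> dot s (chart_asd f u) = 0.
Proof.
move=> Uu; split=> [H|H c /(chart_ElineP _ Uu)[a ->]].
  by apply: H; apply/(chart_ElineP _ Uu); exists 1; rewrite scale1r.
by rewrite dotZr H mulr0.
Qed.

Lemma orthproj_Eline u v : U u ->
  orthproj (Eline L (f u)) v =
    (dot v (chart_asd f u) / dot (chart_asd f u) (chart_asd f u)) *: chart_asd f u.
Proof.
move=> Uu; set w := chart_asd f u.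
have ww : dot w w != 0 by rewrite dot_eq0 chart_asd_neq0.
apply: orthproj_unique => [k a b|//|c].
- move=> /(chart_ElineP _ Uu)[x ->] /(chart_ElineP _ Uu)[y ->].
  by apply/(chart_ElineP _ Uu); rewrite scalerA -scalerDl; eexists.
- by apply/(chart_ElineP _ Uu); eexists.
- move=> /(chart_ElineP _ Uu)[x ->].
  by rewrite dotZr dotBl dotZl divfK // subrr mulr0.
Qed.

Lemma orthproj_tangent u e v : U u -> adapted L (f u) e ->
  orthproj (tangent L (f u)) v =
    dot v (row 0 e) *: row 0 e + dot v (row 1 e) *: row 1 e.
Proof.
move=> Uu ae; have df := chart_differentiable Uu.
have [a0 [a1 [E0 E1 m0]]] := adapted_chart Uu ae.
have [eo _ _] := ae.
apply: orthproj_unique => [k a b|//|c].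
- move=> /(chart_tangentP _ Uu)[x ->] /(chart_tangentP _ Uu)[y ->].
  apply/(chart_tangentP _ Uu); exists (k *: x + 1 *: y).
  by rewrite (deriveDZ _ _ _ _ df) scale1r.
- apply/(chart_tangentP _ Uu).
  by exists (dot v (row 0 e) *: a0 + dot v (row 1 e) *: a1); rewrite (deriveDZ _ _ _ _ df) -E0 -E1.
- move=> /(chart_tangentP _ Uu)[x ->].
  rewrite (minor2_span x m0) (deriveDZ _ _ _ _ df) -E0 -E1 dotDr !dotZr !dotBl !dotDl !dotZl.
  rewrite !(frame_dot eo) /=; ring.
Qed.

End Chart.
End SurfaceGeometry.

(** [h0] and [h1] stand for derivatives of the first two frame vectors. The coefficient [k] collects
    their tangential parts; it moves [asd] along itself only and is therefore left unspecified. *)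
Lemma asd_frame_variation (R : realType) (e : 'M[R]_4) h0 h1 :
  e *m e^T = 1%:M -> \det e = 1 -> exists k,
  asd h0 (row 1 e) + asd (row 0 e) h1 = k *: asd (row 0 e) (row 1 e)
  + (dot h1 (row 2 e) - dot h0 (row 3 e)) *: asd (row 0 e) (row 2 e)
  + (dot h0 (row 2 e) + dot h1 (row 3 e)) *: asd (row 0 e) (row 3 e).
Proof.
move=> eo ed.
exists (omega (coframe e) 0 h0 (row 1 e) + omega (coframe e) 0 (row 0 e) h1).
rewrite (asd_frame eo ed h0 (row 1 e)) (asd_frame eo ed (row 0 e) h1).
rewrite /omega /wedge /coframe /= !(frame_dot eo) /=.
rewrite (dotC h0 (row 2 e)) (dotC h0 (row 3 e)) (dotC h1 (row 2 e)).
rewrite (dotC h1 (row 3 e)).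
move: (asd _ (row 1 e)) (asd _ (row 2 e)) (asd _ (row 3 e)) => w1 w2 w3.
by apply/rowP => i; rewrite !mxE; ring.
Qed.

Lemma dot_cross_frame (R : realType) (e : 'M[R]_4) (w dw : 'rV[R]_3) (m k x y : R) :
  e *m e^T = 1%:M -> m != 0 -> m *: w = asd (row 0 e) (row 1 e) ->
  m *: dw = k *: asd (row 0 e) (row 1 e) + x *: asd (row 0 e) (row 2 e)
    + y *: asd (row 0 e) (row 3 e) ->
  (forall b, dot (cross dw b) w = 0) <-> x = 0 /\ y = 0.
Proof.
move=> eo m0; have D := frame_asd_dot eo.
have d11 := D 1 1 isT isT; have d12 := D 1 2 isT isT; have d13 := D 1 3 isT isT.
have d22 := D 2 2 isT isT; have d23 := D 2 3 isT isT; have d33 := D 3 3 isT isT.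
move: {D} d11 d12 d13 d22 d23 d33; rewrite /=.
move: (asd _ (row 1 e)) (asd _ (row 2 e)) (asd _ (row 3 e)) => w1 w2 w3.
move=> d11 d12 d13 d22 d23 d33 wE dwE.
have E b : m ^+ 2 * dot (cross dw b) w =
    x * dot (cross w2 b) w1 + y * dot (cross w3 b) w1.
  rewrite expr2 -mulrA -dotZr wE -dotZl -crossZl dwE !crossDl !crossZl !dotDl !dotZl.
  by rewrite dot_crossl mulr0 add0r.
split=> [H|[x0 y0] b]; last first.
  have := E b; rewrite x0 y0 !mul0r addr0 => /eqP.
  by rewrite mulf_eq0 expf_eq0 /= (negPf m0) => /eqP.
(* By the double cross product formula these two values of [b] isolate [x] and [y], whatever the
   orientation of [w1, w2, w3]. *)
split; [have := E (cross w1 w2)|have := E (cross w1 w3)];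
  rewrite H mulr0 !cross_cross !dotBl !dotZl ?(dotC w2 w1) ?(dotC w3 w1)
    ?(dotC w3 w2) d11 d12 d13 ?d22 ?d23 ?d33; lra.
Qed.

(** * Parallelism and the shape operator in a chart *)

Section SuperminimalParallel.
Context {R : realType} (L : oriented_surface R).

Lemma parallel_chartP (eta : 'rV[R]_4 -> 'rV[R]_3) : smooth_section_E L eta ->
  parallelE L eta <->
  (forall U f u a, os_charts L U f -> U u ->
     dot ('D_a (eta \o f) u) (chart_asd f u) = 0).
Proof.
move=> [seta _]; split=> H.
  move=> U f u a chart Uu; have param := os_param chart.
  have tu : tangent L (f u) ('D_a f u) by apply/(chart_tangentP chart _ Uu); exists a.
  have := H _ _ (param_mem param Uu) tu.
  rewrite /nablaE (nabla_param param a Uu seta) (orthproj_Eline chart _ Uu).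
  move=> /eqP; rewrite scaler_eq0 (negPf (chart_asd_neq0 chart Uu)) orbF.
  rewrite mulf_eq0 invr_eq0 dot_eq0 (negPf (chart_asd_neq0 chart Uu)) orbF.
  by move/eqP.
move=> p w /os_cover[U [f [chart [u Uu <-]]]] /(chart_tangentP chart _ Uu)[a ->].
rewrite /nablaE (nabla_param (os_param chart) a Uu seta).
by rewrite (orthproj_Eline chart _ Uu) (H _ _ _ _ chart Uu) mul0r scale0r.
Qed.

Section Chart.
Variables (U : set 'rV[R]_2) (f : 'rV[R]_2 -> 'rV[R]_4).
Hypothesis chart : os_charts L U f.

Let param : local_param L U f := os_param chart.

Lemma derive_differentiable u a : U u -> differentiable ('D_a f) u.
Proof. by move=> Uu; have [_ /(_ a) [+ _]] := chart_smooth chart 2; exact. Qed.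

Lemma second_derive_sym u a b : U u -> 'D_a ('D_b f) u = 'D_b ('D_a f) u.
Proof.
move=> Uu; apply: derive_derive_row_sym (chart_open chart) Uu _.
exact: (chart_smooth chart 2).
Qed.

(** Weingarten's equation: differentiate [dot (nu (f v)) ('D_b f v) = 0] in direction [a]. As [a]
    and [b] are constant, the frame [e] enters at the single point [f u]. *)
Lemma shape_coef_chart nu u e a b i j : U u -> normal_field L nu ->
  adapted L (f u) e -> (j == 0) || (j == 1) ->
  row i e = 'D_a f u -> row j e = 'D_b f u ->
  shape_coef L nu (f u) e i j = - dot (nu (f u)) ('D_a ('D_b f) u).
Proof.
move=> Uu [snu nnu] ae j01 Ei Ej; have [eo _ _] := ae.
have oU := chart_open chart.
have snf := smooth_comp_param param snu.
have -> : shape_coef L nu (f u) e i j = dot ('D_a (nu \o f) u) (row j e).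
  rewrite /shape_coef /Defs.shape Ei (nabla_param param a Uu snu).
  rewrite (orthproj_tangent chart _ Uu ae) dotDl !dotZl !(frame_dot eo).
  by case/orP: j01 => /eqP -> /=; rewrite mulr1 mulr0 ?addr0 ?add0r.
apply/eqP; rewrite -addr_eq0 Ej; apply/eqP.
have dnu := smooth_on_differentiable snf Uu.
have := derive_bilin (W := R^o) (@dotDl R 4) (@dotZl R 4)
  (fun a b c => dotDr a b c) (fun k a c => dotZr k a c) a dnu
  (derive_differentiable b Uu).
move=> <-; rewrite -[RHS](@derive_cst _ _ R^o 0 u a).
apply: (@eq_derive_on _ _ R^o U _ (cst 0) u a oU Uu) => v Uv.
apply: nnu; first exact: (param_mem param Uv).
by apply/(chart_tangentP chart ('D_b f v) Uv); exists b.
Qed.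

(* Replacing the coordinate frame by another constant frame of R^2 only rescales
   chart_asd by a constant. *)
Lemma minor2_chart_asd_derive u a a0 a1 : U u ->
  minor2 a0 a1 *: 'D_a (chart_asd f) u =
  asd ('D_a ('D_a0 f) u) ('D_a1 f u) + asd ('D_a0 f u) ('D_a ('D_a1 f) u).
Proof.
move=> Uu; have oU := chart_open chart.
rewrite -(derive_bilin asdDl asdZl asdDr asdZr a (derive_differentiable a0 Uu)
  (derive_differentiable a1 Uu)).
have dW := smooth_on_differentiable (smooth_chart_asd chart) Uu.
rewrite -deriveZ; last exact: diff_derivable.
apply: (@eq_derive_on _ _ _ U (minor2 a0 a1 *: chart_asd f)
  (fun x => asd ('D_a0 f x) ('D_a1 f x)) u a oU Uu) => v Uv.
by rewrite (asd_derive _ _ (chart_differentiable chart Uv)).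
Qed.

Lemma dot_cross_asd_derive u e a0 a1 a : U u -> adapted L (f u) e ->
  row 0 e = 'D_a0 f u -> row 1 e = 'D_a1 f u -> minor2 a0 a1 != 0 ->
  (forall b, dot (cross ('D_a (chart_asd f) u) b) (chart_asd f u) = 0) <->
  dot ('D_a ('D_a1 f) u) (row 2 e) - dot ('D_a ('D_a0 f) u) (row 3 e) = 0 /\
  dot ('D_a ('D_a0 f) u) (row 2 e) + dot ('D_a ('D_a1 f) u) (row 3 e) = 0.
Proof.
move=> Uu [eo ed _] E0 E1 m0.
have [k kE] := asd_frame_variation ('D_a ('D_a0 f) u) ('D_a ('D_a1 f) u) eo ed.
apply: (dot_cross_frame eo m0 (k := k)).
  by rewrite E0 E1 (asd_derive _ _ (chart_differentiable chart Uu)).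
by rewrite (minor2_chart_asd_derive a a0 a1 Uu) -kE E0 E1.
Qed.

End Chart.
End SuperminimalParallel.

(** * Negative superminimality *)

Section NormalFields.
Context {R : realType} (L : oriented_surface R).

Lemma diff_upto_scale (V : normedModType R) n k (U : set V) (s : V -> R^o)
    (v : V -> 'rV[R]_n) : open U ->
  diff_upto k U s -> diff_upto k U v -> diff_upto k U (fun x => s x *: v x).
Proof.
move=> oU ds dv; apply/diff_upto_rowP => // i.
have := diff_uptoM oU ds ((diff_upto_rowP k v oU).1 dv i).
by apply: eq_diff_upto => // x _; rewrite mxE.
Qed.

Lemma diff_upto_dot (V : normedModType R) n k (U : set V) (a b : V -> 'rV[R]_n) :
  open U -> diff_upto k U a -> diff_upto k U b ->
  diff_upto k U (fun x => dot (a x) (b x) : R^o).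
Proof.
exact: (diff_upto_bilin (W := R^o) (@dotDl R n) (@dotZl R n)
  (fun a b c => dotDr a b c) (fun k a c => dotZr k a c)).
Qed.

(** Cramer's rule for the orthogonal projection to the span of [a] and [b]; by [dot_asd_common] the
    denominator is their Gram determinant. The formula is visibly smooth in a chart, whereas adapted
    frames are only chosen pointwise. *)
Definition span_proj (a b v : 'rV[R]_4) : 'rV[R]_4 :=
  (dot (asd a b) (asd a b))^-1 *:
    ((dot v a * dot b b - dot v b * dot a b) *: a
     + (dot v b * dot a a - dot v a * dot a b) *: b).

Lemma dot_span_proj a b v x y : asd a b != 0 ->
  dot (v - span_proj a b v) (x *: a + y *: b) = 0.
Proof.
move=> ab0; have : dot (asd a b) (asd a b) != 0 by rewrite dot_eq0.
rewrite dotBl /span_proj dotZl !dotDl !dotZl !dotDr !dotZr (dotC b a).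
rewrite dot_asd_common; move: (dot a a) (dot a b) (dot b b) => A B C D0.
by field.
Qed.

Lemma span_projE a b v : exists x y, span_proj a b v = x *: a + y *: b.
Proof. by rewrite /span_proj scalerDr !scalerA; do 2 eexists. Qed.

Lemma span_proj_normal a b v : dot v a = 0 -> dot v b = 0 -> span_proj a b v = 0.
Proof.
by move=> va vb; rewrite /span_proj va vb !mul0r subrr !scale0r addr0 scaler0.
Qed.

Section Chart.
Variables (U : set 'rV[R]_2) (f : 'rV[R]_2 -> 'rV[R]_4).
Hypothesis chart : os_charts L U f.

Lemma orthproj_tangent_chart u v : U u ->
  orthproj (tangent L (f u)) v = span_proj ('D_e0 f u) ('D_e1 f u) v.
Proof.
move=> Uu; have df := chart_differentiable chart Uu.
have W0 := chart_asd_neq0 chart Uu; rewrite /chart_asd in W0.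
apply: orthproj_unique => [k a b|//|c].
- move=> /(chart_tangentP chart _ Uu)[x ->] /(chart_tangentP chart _ Uu)[y ->].
  apply/(chart_tangentP chart _ Uu); exists (k *: x + 1 *: y).
  by rewrite (deriveDZ _ _ _ _ df) scale1r.
- have [x [y ->]] := span_projE ('D_e0 f u) ('D_e1 f u) v.
  by apply/(chart_tangentP chart _ Uu); exists (x *: e0 + y *: e1);
    rewrite (deriveDZ _ _ _ _ df).
- move=> /(chart_tangentP chart _ Uu)[x ->].
  by rewrite (derive_row2 x df) dot_span_proj.
Qed.

Lemma smooth_span_proj N :
  smooth_on U (fun u => N - span_proj ('D_e0 f u) ('D_e1 f u) N).
Proof.
have oU := chart_open chart.
move=> k; have [_ Df] := chart_smooth chart k.+1.
have cst_N := diff_upto_cst k U N.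
have minus (s t : 'rV[R]_2 -> R^o) : diff_upto k U s -> diff_upto k U t ->
    diff_upto k U (fun x => s x - t x : R^o).
  move=> ds dt.
  apply: (eq_diff_upto oU _ (diff_uptoD oU ds
    (diff_uptoM oU (diff_upto_cst k U (-1 : R^o)) dt))) => x _.
  by rewrite /cst mulN1r.
have dD (a b : 'rV[R]_2) := diff_upto_dot oU (Df a) (Df b).
have dN a := diff_upto_dot oU cst_N (Df a).
have dW := diff_upto_dot oU (smooth_chart_asd chart k) (smooth_chart_asd chart k).
have W0 u : U u -> dot (chart_asd f u) (chart_asd f u) != 0.
  by move=> Uu; rewrite dot_eq0 (chart_asd_neq0 chart Uu).
have H1 := minus _ _ (diff_uptoM oU (dN e0) (dD e1 e1))
  (diff_uptoM oU (dN e1) (dD e0 e1)).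
have H2 := minus _ _ (diff_uptoM oU (dN e1) (dD e0 e0))
  (diff_uptoM oU (dN e0) (dD e0 e1)).
have H3 := diff_upto_scale oU (diff_uptoV oU W0 dW)
  (diff_uptoD oU (diff_upto_scale oU H1 (Df e0)) (diff_upto_scale oU H2 (Df e1))).
have H4 := diff_uptoD oU cst_N
  (diff_upto_scale oU (diff_upto_cst k U (-1 : R^o)) H3).
apply: (eq_diff_upto oU _ H4) => u _.
by rewrite /cst scaleN1r.
Qed.

End Chart.

(** With a local retraction [r], the map [nu \o f \o r] is a smooth extension. *)
Lemma smooth_along_chart n (nu : 'rV[R]_4 -> 'rV[R]_n) :
  (forall U f, os_charts L U f -> smooth_on U (nu \o f)) -> smooth_along L nu.
Proof.
move=> H p /os_cover[U [f [chart [u Uu <-]]]].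
have [N [r [oN Np sr rU fr]]] := local_retraction (os_param chart) Uu.
exists N, (nu \o f \o r); split=> //.
- move=> k; apply: (diff_upto_comp_row oN (chart_open chart) rU (sr k)).
  exact: H.
- by move=> x Nx Lx /=; rewrite fr.
Qed.

(** Subtract from the constant field [N] its tangential part; at [p] nothing is subtracted. The
    field is global, so no cut-off is involved. As superminimality is stated through fields,
    equations at a point can be extracted from it only thanks to this. *)
Lemma normal_field_exists p N : os_set L p ->
  (forall w, tangent L p w -> dot N w = 0) ->
  exists nu, normal_field L nu /\ nu p = N.
Proof.
move=> Lp NP; exists (fun x => N - orthproj (tangent L x) N); split; last first.
  have [U [f [chart [u Uu E]]]] := os_cover Lp.
  have ND a : dot N ('D_a f u) = 0.
    by apply: NP; rewrite -E; apply/(chart_tangentP chart ('D_a f u) Uu); exists a.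
  rewrite -E (orthproj_tangent_chart chart N Uu).
  by rewrite (span_proj_normal (ND e0) (ND e1)) subr0.
split.
  apply: smooth_along_chart => U f chart k.
  apply: (eq_diff_upto (chart_open chart) _ (smooth_span_proj chart N k)) => u Uu.
  by rewrite /= (orthproj_tangent_chart chart N Uu).
move=> x w /os_cover[U [f [chart [u Uu <-]]]] /(chart_tangentP chart _ Uu)[a ->].
rewrite (orthproj_tangent_chart chart N Uu).
rewrite (derive_row2 a (chart_differentiable chart Uu)) dot_span_proj //.
exact: (chart_asd_neq0 chart Uu).
Qed.

Lemma adapted_normal p e t2 t3 : os_set L p -> adapted L p e ->
  forall w, tangent L p w -> dot (t2 *: row 2 e + t3 *: row 3 e) w = 0.
Proof.
move=> /os_cover[U [f [chart [u Uu <-]]]] ae w /(chart_tangentP chart _ Uu)[a ->].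
have [a0 [a1 [E0 E1 m0]]] := adapted_chart chart Uu ae.
have [eo _ _] := ae.
rewrite (minor2_span a m0) (deriveDZ _ _ _ _ (chart_differentiable chart Uu)).
rewrite -E0 -E1 !dotDl !dotDr !dotZl !dotZr !(frame_dot eo) /=.
by rewrite !mulr0 !addr0.
Qed.

(** The equations are linear in [(t2, t3)], so testing [(1, 0)] and [(0, 1)] suffices. The inner
    minus signs are those of [shape_coef_chart]. *)
Lemma frame_superminimal_eq (e2' e3' h00 h01 h11 : 'rV[R]_4) :
  (forall t2 t3 : R,
     - dot (t2 *: e2' + t3 *: e3') h01 - - dot (- t3 *: e2' + t2 *: e3') h00 = 0 /\
     - dot (t2 *: e2' + t3 *: e3') h11 - - dot (- t3 *: e2' + t2 *: e3') h01 = 0) <->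
  [/\ dot h01 e2' - dot h00 e3' = 0, dot h00 e2' + dot h01 e3' = 0,
      dot h11 e2' - dot h01 e3' = 0 & dot h01 e2' + dot h11 e3' = 0].
Proof.
split=> [H|[A B C D] t2 t3].
  have [A1 A2] := H 1 0; have [B1 B2] := H 0 1.
  move: A1 A2 B1 B2; rewrite !dotDl !dotZl !(dotC e2') !(dotC e3') => *.
  by split; lra.
rewrite !dotDl !dotZl !(dotC e2') !(dotC e3').
split.
  transitivity (- t2 * (dot h01 e2' - dot h00 e3') - t3 * (dot h00 e2' + dot h01 e3')).
    by ring.
  by rewrite A B; ring.
transitivity (- t2 * (dot h11 e2' - dot h01 e3') - t3 * (dot h01 e2' + dot h11 e3')).
  by ring.
by rewrite C D; ring.
Qed.

(** The first two hypotheses are the condition in the first tangent direction, the last two that in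
    the second; the condition is linear in the direction. *)
Lemma frame_eq_span (e2' e3' h00 h01 h11 : 'rV[R]_4) x y :
  dot h01 e2' - dot h00 e3' = 0 -> dot h00 e2' + dot h01 e3' = 0 ->
  dot h11 e2' - dot h01 e3' = 0 -> dot h01 e2' + dot h11 e3' = 0 ->
  dot (x *: h01 + y *: h11) e2' - dot (x *: h00 + y *: h01) e3' = 0 /\
  dot (x *: h00 + y *: h01) e2' + dot (x *: h01 + y *: h11) e3' = 0.
Proof.
move=> A B C D; rewrite !dotDl !dotZl; split.
  transitivity (x * (dot h01 e2' - dot h00 e3') + y * (dot h11 e2' - dot h01 e3')).
    by ring.
  by rewrite A C; ring.
transitivity (x * (dot h00 e2' + dot h01 e3') + y * (dot h01 e2' + dot h11 e3')).
  by ring.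
by rewrite B D; ring.
Qed.

Lemma superminimal_chartP : negative_superminimal L <->
  (forall U f u a, os_charts L U f -> U u -> forall b,
     dot (cross ('D_a (chart_asd f) u) b) (chart_asd f u) = 0).
Proof.
have shapes U f u e a0 a1 (chart : os_charts L U f) (Uu : U u)
    (ae : adapted L (f u) e) (E0 : row 0 e = 'D_a0 f u) (E1 : row 1 e = 'D_a1 f u)
    nu (nn : normal_field L nu) :=
  (shape_coef_chart chart (i := 0) (j := 1) Uu nn ae isT E0 E1,
   shape_coef_chart chart (i := 0) (j := 0) Uu nn ae isT E0 E0,
   shape_coef_chart chart (i := 1) (j := 1) Uu nn ae isT E1 E1).
split=> H.
  move=> U f u a chart Uu.
  have [e ae] := adapted_exists chart Uu.
  have Lp := param_mem (os_param chart) Uu.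
  have [a0 [a1 [E0 E1 m0]]] := adapted_chart chart Uu ae.
  have [|A B C D] := (frame_superminimal_eq (row 2 e) (row 3 e) ('D_a0 ('D_a0 f) u)
    ('D_a0 ('D_a1 f) u) ('D_a1 ('D_a1 f) u)).1.
    move=> t2 t3.
    have [nu [nn nuE]] := normal_field_exists Lp (adapted_normal t2 t3 Lp ae).
    have [np [nnp npE]] := normal_field_exists Lp (adapted_normal (- t3) t2 Lp ae).
    have := H _ _ Lp ae t2 t3 nu np nn nnp nuE npE.
    have S := shapes _ _ _ _ _ _ chart Uu ae E0 E1.
    by rewrite !(S nu nn) !(S np nnp) nuE npE.
  apply/(dot_cross_asd_derive chart a Uu ae E0 E1 m0).
  (* The shape coefficients involve ['D_a0 ('D_a1 f)] alone; differentiating [chart_asd] along [a1]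
     also produces the opposite order. *)
  have sym := second_derive_sym chart a1 a0 Uu.
  have [x [y ->]] : exists x y, a = x *: a0 + y *: a1.
    by do 2 eexists; exact: minor2_span.
  have -> : 'D_(x *: a0 + y *: a1) ('D_a0 f) u =
      x *: 'D_a0 ('D_a0 f) u + y *: 'D_a0 ('D_a1 f) u.
    by rewrite (deriveDZ _ _ _ _ (derive_differentiable chart a0 Uu)) sym.
  rewrite (deriveDZ _ _ _ _ (derive_differentiable chart a1 Uu)).
  exact: frame_eq_span.
move=> p e Lp ae t2 t3 nu np nn nnp nuE npE.
have [U [f [chart [u Uu E]]]] := os_cover Lp.
rewrite -E in ae nuE npE *.
have [a0 [a1 [E0 E1 m0]]] := adapted_chart chart Uu ae.
have S := shapes _ _ _ _ _ _ chart Uu ae E0 E1.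
rewrite !(S nu nn) !(S np nnp) nuE npE.
apply: (frame_superminimal_eq _ _ _ _ _).2.
have [A B] := (dot_cross_asd_derive chart a0 Uu ae E0 E1 m0).1 (H _ _ _ _ chart Uu).
have [C D] := (dot_cross_asd_derive chart a1 Uu ae E0 E1 m0).1 (H _ _ _ _ chart Uu).
by rewrite (second_derive_sym chart a1 a0 Uu) in C D.
Qed.

End NormalFields.

(** * The total space *)

Section TotalSpace.
Context {R : realType} (L : oriented_surface R) (eta : 'rV[R]_4 -> 'rV[R]_3).
Hypothesis heta : smooth_section_E L eta.
Variables (U : set 'rV[R]_2) (f : 'rV[R]_2 -> 'rV[R]_4).
Hypothesis chart : os_charts L U f.

Let param : local_param L U f := os_param chart.

Lemma smooth_eta_chart : smooth_on U (eta \o f).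
Proof. exact: (smooth_comp_param param heta.1). Qed.

(* The fibre F is the image of the cross product with a generator of E. *)
Definition Xeta_lift (V : Type) (mu : V -> 'rV[R]_2) (beta : V -> 'rV[R]_3)
    (x : V) : Defs.total R :=
  (f (mu x), eta (f (mu x)) + cross (chart_asd f (mu x)) (beta x)).

Lemma Xeta_lift_mem V (mu : V -> 'rV[R]_2) beta x :
  U (mu x) -> Xeta L eta (Xeta_lift mu beta x).
Proof.
move=> Ux; split; first exact: (param_mem param Ux).
exists (cross (chart_asd f (mu x)) (beta x)) => //.
by apply/(chart_FplaneP chart _ Ux); rewrite dot_crossl.
Qed.

Section Lift.
Variables (V : normedModType R) (mu : V -> 'rV[R]_2) (beta : V -> 'rV[R]_3).

(** The maps [mu] and [beta] stay arbitrary for two uses: affine lines give curves in [X_eta],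
    linear projections of R^4 its local parametrisations. *)
Lemma smooth_Xeta_lift (A : set V) : open A -> smooth_on A mu ->
  smooth_on A beta -> (forall x, A x -> U (mu x)) ->
  smooth_on A (Xeta_lift mu beta).
Proof.
move=> oA smu sbeta AU k; have oU := chart_open chart.
apply: diff_upto_pair => //.
  exact: (diff_upto_comp_row oA oU AU (smu k) (chart_smooth chart k)).
apply: diff_uptoD => //.
  exact: (diff_upto_comp_row oA oU AU (smu k) (smooth_eta_chart k)).
exact: (diff_upto_bilin (@crossDl R) (@crossZl R) (fun a b c => crossDr a b c)
  (fun k a c => crossZr k a c) oA
  (diff_upto_comp_row oA oU AU (smu k) (smooth_chart_asd chart k)) (sbeta k)).
Qed.

Lemma derive_Xeta_lift x v a : differentiable mu x -> differentiable beta x ->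
  U (mu x) -> 'D_v mu x = a -> 'D_v (Xeta_lift mu beta) x =
  ('D_a f (mu x), 'D_a (eta \o f) (mu x) +
     (cross ('D_a (chart_asd f) (mu x)) (beta x)
      + cross (chart_asd f (mu x)) ('D_v beta x))).
Proof.
move=> dmu dbeta Ux <-.
have df := chart_differentiable chart Ux.
have de := smooth_on_differentiable smooth_eta_chart Ux.
have dW := smooth_on_differentiable (smooth_chart_asd chart) Ux.
have d1 := differentiable_comp dmu df.
have d2 := differentiable_comp dmu de.
have d3 := differentiable_comp dmu dW.
have cDr (a b c : 'rV[R]_3) := crossDr a b c.
have cZr k (a c : 'rV[R]_3) := crossZr k a c.
have d4 := differentiable_bilin_comp (@crossDl R) (@crossZl R) cDr cZr d3 dbeta.
rewrite (derive_pair v d1 (differentiableD d2 d4)).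
rewrite (deriveD (@diff_derivable _ _ _ _ x v d2) (@diff_derivable _ _ _ _ x v d4)).
rewrite (derive_comp v dmu df) (derive_comp v dmu de).
rewrite (derive_bilin (@crossDl R) (@crossZl R) cDr cZr v d3 dbeta).
by rewrite (derive_comp v dmu dW).
Qed.

End Lift.

Lemma Xeta_tangent u a b c : U u -> tangent (Xeta L eta)
  (f u, eta (f u) + cross (chart_asd f u) b)
  ('D_a f u, 'D_a (eta \o f) u +
     (cross ('D_a (chart_asd f) u) b + cross (chart_asd f u) c)).
Proof.
move=> Uu; have oU := chart_open chart.
pose mu (t : R^o) := t *: a + u; pose beta (t : R^o) := t *: c + b.
have smu I := @smooth_line _ _ u a I; have sbeta I := @smooth_line _ _ b c I.
pose I := setT `&` mu @^-1` U.
have oI : open I.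
  apply: open_preimage oU => [|t _]; first exact: openT.
  by apply: (smooth_on_continuous (smooth_line u a openT)).
have mu0 : mu 0 = u by rewrite /mu scale0r add0r.
have beta0 : beta 0 = b by rewrite /beta scale0r add0r.
have I0 : I 0 by split=> //; rewrite /preimage /= mu0.
exists (Xeta_lift mu beta); split; last split.
- exists I; split=> //.
    by apply: smooth_Xeta_lift => //; [exact: smu|exact: sbeta|move=> t []].
  by move=> t [_ Ut]; exact: Xeta_lift_mem.
- by rewrite /Xeta_lift mu0 beta0.
- have dline (W : normedModType R) (p q : W) : 'D_1 (fun t : R^o => t *: p + q) 0 = p.
    by have [dl el] := is_diff_line q p 0; rewrite (deriveE _ dl) el scale1r.
  rewrite derive1E.
  have dmu : differentiable mu 0 by have [] := is_diff_line u a 0.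
  have dbeta : differentiable beta 0 by have [] := is_diff_line b c 0.
  rewrite (derive_Xeta_lift dmu dbeta _ (dline _ a u)) mu0 //.
  by rewrite (dline _ c b) beta0.
Qed.

Lemma coassociative_chart : coassociative (Xeta L eta) ->
  forall u a b, U u ->
  dot ('D_a (eta \o f) u + cross ('D_a (chart_asd f) u) b) (chart_asd f u) = 0.
Proof.
move=> [_ H] u a b Uu; set w := chart_asd f u.
have w0 : w != 0 := chart_asd_neq0 chart Uu.
have [b1 wb1] := cross_neq0 w0.
(* With this choice the cross product of [cross w b1] and [cross w b2] is [w] times the squared norm
   of [cross w b1], which is nonzero. *)
pose b2 := cross w b1.
have Xp : Xeta L eta (f u, eta (f u) + cross w b).
  exact: (@Xeta_lift_mem _ (fun _ : unit => u) (fun => b) tt).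
have T a' c := Xeta_tangent a' b c Uu.
have D0 n (g : 'rV[R]_2 -> 'rV[R]_n) : 'D_0 g u = 0 by exact: derive0.
(* Direction 0 in the base gives vertical vectors. Every term of [phi] other than the triple product
   has the horizontal part of one of them as an argument of [asd], hence vanishes. *)
have := H _ Xp _ _ _ (T a 0) (T 0 b1) (T 0 b2).
rewrite !D0 phiE /= -/w.
rewrite !asd0l !asd0r !cross0l cross0r !dot0r !addr0 !add0r.
rewrite dot_cross_rot cross_cross_dot dotZl => /eqP.
rewrite mulf_eq0 => /orP[|/eqP]; last by rewrite dotC.
by rewrite dot_eq0 (negPf wb1).
Qed.

End TotalSpace.

(** * Velocities of arbitrary curves in the total space *)

Section Converse.
Context {R : realType} (L : oriented_surface R) (eta : 'rV[R]_4 -> 'rV[R]_3).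
Hypothesis heta : smooth_section_E L eta.

(** On the plane orthogonal to [w], applying [cross w] twice is multiplication by [- dot w w]. *)
Lemma cross_span (w s : 'rV[R]_3) : w != 0 -> dot s w = 0 ->
  exists b, s = cross w b.
Proof.
move=> w0 sw; exists (- (dot w w)^-1 *: cross w s).
rewrite crossZr cross_cross (dotC w s) sw scale0r sub0r scalerN scaleNr opprK.
by rewrite scalerA mulVf ?scale1r // dot_eq0.
Qed.

(** Three vectors in a plane have no volume; the identity [E] is Cramer's rule for expressing [w]
    through [x, y, z]. *)
Lemma dot_cross_eq0 (w x y z : 'rV[R]_3) : w != 0 ->
  dot x w = 0 -> dot y w = 0 -> dot z w = 0 -> dot (cross x y) z = 0.
Proof.
move=> w0 xw yw zw.
have E : dot (cross x y) z *: w =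
    dot x w *: cross y z + dot y w *: cross z x + dot z w *: cross x y.
  apply/rowP; apply: forall3P;
    rewrite !dot3E /cross !(row3E, mxE); ring.
move/eqP: E; rewrite xw yw zw !scale0r !addr0 scaler_eq0 (negPf w0) orbF.
by move/eqP.
Qed.

Section Chart.
Variables (U : set 'rV[R]_2) (f : 'rV[R]_2 -> 'rV[R]_4).
Hypothesis chart : os_charts L U f.

Let param : local_param L U f := os_param chart.

Hypothesis cond : forall u a b, U u ->
  dot ('D_a (eta \o f) u + cross ('D_a (chart_asd f) u) b) (chart_asd f u) = 0.

(** Along the curve, the fibre part minus [eta] is orthogonal to [w]. Differentiating this and
    writing that difference at time 0 as [cross w b] gives [dot v.2 w] as the left side of [cond],
    since the triple product is alternating. *)
Lemma Xeta_tangent_inv u z v : U u -> z.1 = f u -> tangent (Xeta L eta) z v ->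
  exists a, v.1 = 'D_a f u /\ dot v.2 (chart_asd f u) = 0.
Proof.
move=> Uu zu [C Cv]; have dC := curve_differentiable Cv.
have [[I [oI I0 sC CX]] [C0 C1]] := Cv.
pose c := fst \o C; pose d := snd \o C.
have dc : differentiable c 0.
  apply: differentiable_comp => //; apply: linear_differentiable.
  by move=> x; exact: cvg_fst.
have dd : differentiable d 0.
  apply: differentiable_comp => //; apply: linear_differentiable.
  by move=> x; exact: cvg_snd.
have cd : 'D_1 C 0 = ('D_1 c 0, 'D_1 d 0).
  rewrite -(derive_pair (1 : R^o) dc dd).
  have CE : C = fun t => (c t, d t).
    by apply/funext => t; rewrite /c /d /=; case: (C t).
  by rewrite [in LHS]CE.
have [c1 d1] : v.1 = 'D_1 c 0 /\ v.2 = 'D_1 d 0.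
  by rewrite -C1 derive1E cd.
have c0 : c 0 = f u by rewrite /c /= C0.
have [N [r [oN Np sr rU fr]]] := local_retraction param Uu.
have ru := retraction_paramK param Uu rU fr Np.
pose mu := r \o c.
have mu0 : mu 0 = u by rewrite /mu /= c0.
have dr : differentiable r (c 0).
  by rewrite c0; exact: smooth_on_differentiable sr Np.
have dmu : differentiable mu 0 := differentiable_comp dc dr.
have nearI : \forall t \near (0 : R^o), I t /\ N (c t).
  have Nc : \forall t \near (0 : R^o), N (c t).
    have cc := differentiable_continuous dc.
    by apply: cc; rewrite c0; exact: (near_in oN Np).
  by apply: filterS2 (near_in oI I0) Nc.
have fmu t : I t /\ N (c t) -> f (mu t) = c t.
  by move=> [It Nt]; apply: fr => //; have [] := CX t It.
pose a := 'D_1 mu 0; exists a.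
have df := chart_differentiable chart Uu.
have de := smooth_on_differentiable (smooth_eta_chart heta chart) Uu.
have dW := smooth_on_differentiable (smooth_chart_asd chart) Uu.
split.
  have E : 'D_1 (f \o mu) 0 = 'D_1 c 0.
    by apply: near_eq_derive; apply: filterS nearI => t; exact: fmu.
  have dfm : differentiable f (mu 0) by rewrite mu0.
  by rewrite c1 -E (derive_comp (1 : R^o) dmu dfm) mu0.
have dem : differentiable (eta \o f) (mu 0) by rewrite mu0.
have dWm : differentiable (chart_asd f) (mu 0) by rewrite mu0.
pose g1 := d - ((eta \o f) \o mu); pose g2 := chart_asd f \o mu.
have dg1 : differentiable g1 0.
  by apply: differentiableB => //; exact: differentiable_comp.
have dg2 : differentiable g2 0 := differentiable_comp dmu dWm.
have g0 t : I t /\ N (c t) -> dot (g1 t) (g2 t) = 0.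
  move=> It; have := fmu t It; have [It' Nt] := It => fm.
  have Ct : (C t).1 = f (mu t) by rewrite fm.
  have [_ [s]] := CX t It'; rewrite Ct.
  move=> /(chart_FplaneP chart _ (rU _ Nt)) sW E.
  have -> : g1 t = s; last exact: sW.
  by rewrite /g1 /d /= -[LHS]/((C t).2 - eta (f (mu t))) E addrAC subrr add0r.
have D0 : 'D_1 (fun t : R^o => dot (g1 t) (g2 t) : R^o) 0 = 0.
  rewrite -[RHS](@derive_cst _ _ R^o 0 (0 : R^o) 1).
  by apply: near_eq_derive; apply: filterS nearI => t; exact: g0.
move: D0; rewrite (derive_bilin (W := R^o) (@dotDl R 3) (@dotZl R 3)
  (fun a b c => dotDr a b c) (fun k a c => dotZr k a c) (1 : R^o) dg1 dg2).
have dem' : differentiable ((eta \o f) \o mu) 0 := differentiable_comp dmu dem.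
have -> : 'D_1 g1 0 = v.2 - 'D_a (eta \o f) u.
  rewrite /g1 (deriveB (@diff_derivable _ _ _ _ _ _ dd)
    (@diff_derivable _ _ _ _ _ _ dem')).
  by rewrite (derive_comp (1 : R^o) dmu dem) mu0 d1.
have -> : 'D_1 g2 0 = 'D_a (chart_asd f) u by rewrite /g2 (derive_comp (1 : R^o) dmu dWm) mu0.
have g20 : g2 0 = chart_asd f u by rewrite /g2 /= mu0.
have [b bE] : exists b, g1 0 = cross (chart_asd f u) b.
  apply: cross_span; first exact: (chart_asd_neq0 chart Uu).
  have Nc0 : N (c 0) by rewrite c0.
  by have := g0 0 (conj I0 Nc0); rewrite g20.
rewrite g20 bE; have := cond a b Uu.
move: ('D_a (eta \o f) u) ('D_a (chart_asd f) u) (chart_asd f u) => x y w.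
have -> : dot (cross w b) y = - dot (cross y b) w.
  by rewrite !dot3E /cross !row3E; ring.
by rewrite dotDl dotBl; lra.
Qed.

End Chart.
End Converse.

(** * Local parametrisations of the total space *)

Section Submanifold.
Context {R : realType} (L : oriented_surface R) (eta : 'rV[R]_4 -> 'rV[R]_3).
Hypothesis heta : smooth_section_E L eta.
Variables (U : set 'rV[R]_2) (f : 'rV[R]_2 -> 'rV[R]_4).
Hypothesis chart : os_charts L U f.

Let param : local_param L U f := os_param chart.

Lemma smooth_fst (V W : normedModType R) (A : set (V * W)%type) :
  smooth_on A (@fst V W).
Proof. by move=> k; apply: diff_upto_linear => x; exact: cvg_fst. Qed.

Lemma smooth_snd (V W : normedModType R) (A : set (V * W)%type) :
  smooth_on A (@snd V W).
Proof. by move=> k; apply: diff_upto_linear => x; exact: cvg_snd. Qed.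

Variables b1 b2 : 'rV[R]_3.

(** Triple product of [w], [b1] and [b2]. Where it is nonzero, [cross w b1] and [cross w b2] form a
    basis of [F], so constant [b1] and [b2] trivialise [F] over an open set. *)
Definition fibre_det u := dot (cross (chart_asd f u) b1) b2.

Definition base_mx : 'M[R]_(4, 2) := \matrix_(i, j) (i == j :> nat)%:R.

Definition fibre_mx : 'M[R]_(4, 3) :=
  \matrix_(i < 4) match val i with 2%N => b1 | 3%N => b2 | _ => 0 end.

Definition fibre_chart : 'rV[R]_4 -> Defs.total R :=
  Xeta_lift eta f (mulmxr base_mx) (mulmxr fibre_mx).

Definition fibre_dom : set 'rV[R]_4 :=
  [set z | U (z *m base_mx) /\ fibre_det (z *m base_mx) != 0].

Lemma base_mxE (z : 'rV[R]_4) : z *m base_mx = z 0 0 *: e0 + z 0 1 *: e1.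
Proof.
apply/rowP => j; rewrite mxE sum4E !mxE; move: j.
by apply: forall2P => /=; ring.
Qed.

Lemma fibre_mxE (z : 'rV[R]_4) : z *m fibre_mx = z 0 2 *: b1 + z 0 3 *: b2.
Proof. by rewrite mulmx_sum_row sum4E !rowK /= !scaler0 !add0r. Qed.

Lemma fibre_mx_eq (z z' : 'rV[R]_4) : z *m base_mx = z' *m base_mx ->
  z 0 2 = z' 0 2 -> z 0 3 = z' 0 3 -> z = z'.
Proof.
rewrite !base_mxE => /rowP E z2 z3.
have := E 0; have := E 1; rewrite !mxE /=.
rewrite !(mulr0, mulr1, addr0, add0r) => z1 z0.
by apply/rowP; apply: forall4P.
Qed.

(** Pairing with [b2] kills the [b2] term, so the fibre coordinates can be read off; likewise with
    [b1] below. *)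
Lemma dot_fibrer u s2 s3 :
  dot (cross (chart_asd f u) (s2 *: b1 + s3 *: b2)) b2 = s2 * fibre_det u.
Proof.
by rewrite crossDr !crossZr !dotDl !dotZl !dot_crossr mulr0 addr0.
Qed.

Lemma dot_fibrel u s2 s3 :
  dot (cross (chart_asd f u) (s2 *: b1 + s3 *: b2)) b1 = - (s3 * fibre_det u).
Proof.
rewrite crossDr !crossZr !dotDl !dotZl !dot_crossr mulr0 add0r /fibre_det -mulrN.
by congr (_ * _); move: (chart_asd f u) => w; rewrite !dot3E /cross !row3E; ring.
Qed.

Lemma smooth_fibre_det : smooth_on U (fibre_det : 'rV[R]_2 -> R^o).
Proof.
have oU := chart_open chart; move=> k; apply: diff_upto_dot => //.
  exact: (diff_upto_bilin (@crossDl R) (@crossZl R) (fun a b c => crossDr a b c)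
    (fun k a c => crossZr k a c) oU (smooth_chart_asd chart k) (diff_upto_cst k U b1)).
exact: diff_upto_cst.
Qed.

Lemma open_fibre_base : open [set u | U u /\ fibre_det u != 0].
Proof.
have fc u : U u -> {for u, continuous (fibre_det : 'rV[R]_2 -> R^o)}.
  exact: (smooth_on_continuous smooth_fibre_det).
exact: (open_preimage (chart_open chart) fc (open_neq (y := 0))).
Qed.

Lemma open_fibre_dom : open fibre_dom.
Proof.
rewrite -[fibre_dom]setTI.
apply: (@open_preimage _ _ _ setT (mulmxr base_mx) _ openT _ open_fibre_base).
by move=> x _; exact: continuous_mulmxr.
Qed.

Lemma smooth_fibre_chart : smooth_on fibre_dom fibre_chart.
Proof.
apply: (smooth_Xeta_lift heta chart open_fibre_dom) => [||x []//].
  exact: (smooth_mulmxr base_mx open_fibre_dom).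
exact: (smooth_mulmxr fibre_mx open_fibre_dom).
Qed.

Lemma fibre_chart_inj z z' : fibre_dom z -> fibre_dom z' ->
  fibre_chart z = fibre_chart z' -> z = z'.
Proof.
move=> [Uz dz] [Uz' dz'] [E1 E2].
have [_ _ finj _ _] := param.
have bE : z *m base_mx = z' *m base_mx by exact: finj.
move: E2; rewrite /= bE => /addrI; rewrite !fibre_mxE => E.
rewrite bE in dz.
have := congr1 (fun v => dot v b2) E; have := congr1 (fun v => dot v b1) E; rewrite !(dot_fibrel, dot_fibrer).
by move=> /oppr_inj/(mulIf dz) z3 /(mulIf dz) z2; exact: fibre_mx_eq.
Qed.

Lemma fibre_chart_immersion z : fibre_dom z -> injective ('d fibre_chart z).
Proof.
move=> Dz; have [Uz dz] := Dz.
have dg := smooth_on_differentiable smooth_fibre_chart Dz.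
suff H x : 'd fibre_chart z x = 0 -> x = 0.
  move=> x y E; apply/eqP; rewrite -subr_eq0; apply/eqP; apply: H.
  by rewrite linearB /= E subrr.
have dlin m (M : 'M[R]_(4, m)) :
    differentiable (mulmxr M : 'rV[R]_4 -> 'rV[R]_m) z /\
    'D_x (mulmxr M : 'rV[R]_4 -> 'rV[R]_m) z = x *m M.
  have cM := @continuous_mulmxr _ _ _ M.
  have dM : differentiable (mulmxr M : 'rV[R]_4 -> 'rV[R]_m) z.
    exact: linear_differentiable.
  by split=> //; rewrite (deriveE _ dM) diff_lin.
have [db eb] := dlin _ base_mx; have [df ef] := dlin _ fibre_mx.
rewrite -(deriveE _ dg) (derive_Xeta_lift heta chart db df Uz eb) ef.
move=> [E1 E2]; have xb := chart_derive_inj chart Uz E1.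
move: E2; rewrite /= xb !derive0 add0r cross0l add0r fibre_mxE => E.
have := congr1 (fun v => dot v b2) E; have := congr1 (fun v => dot v b1) E; rewrite /= !dot0l.
rewrite !(dot_fibrel, dot_fibrer) => /eqP; rewrite oppr_eq0 mulf_eq0 (negPf dz) orbF.
move=> /eqP x3 /eqP; rewrite mulf_eq0 (negPf dz) orbF => /eqP x2.
by apply: fibre_mx_eq; rewrite ?mul0mx // ?x2 ?x3 mxE.
Qed.

(** The argument on the left is [cross s (cross b1 b2)]; expand the double cross product once more
    and use that [s] is orthogonal to [w]. *)
Lemma fibre_coord (w s : 'rV[R]_3) : dot s w = 0 ->
  cross w (dot s b2 *: b1 - dot s b1 *: b2) = dot (cross w b1) b2 *: s.
Proof.
move=> sw; rewrite -cross_cross (cross_cross w) (dotC w s) sw scale0r subr0.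
by rewrite (dot_cross_rot w) dotC.
Qed.

Definition fibre_lift (u : 'rV[R]_2) (s : 'rV[R]_3) : 'rV[R]_4 :=
  row4 (u 0 0) (u 0 1) (dot s b2 / fibre_det u) (- (dot s b1 / fibre_det u)).

Lemma fibre_lift_base u s : fibre_lift u s *m base_mx = u.
Proof. by rewrite base_mxE /fibre_lift !row4E -row2_expand. Qed.

Lemma fibre_liftK u s : fibre_det u != 0 -> dot s (chart_asd f u) = 0 ->
  fibre_chart (fibre_lift u s) = (f u, eta (f u) + s).
Proof.
move=> du su; rewrite /fibre_chart /Xeta_lift /= fibre_lift_base.
have -> : fibre_lift u s *m fibre_mx =
    (fibre_det u)^-1 *: (dot s b2 *: b1 - dot s b1 *: b2).
  rewrite fibre_mxE /fibre_lift !row4E scalerBr !scalerA scaleNr.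
  by rewrite ![(fibre_det _)^-1 * _]mulrC.
by rewrite crossZr fibre_coord // scalerA mulVf // scale1r.
Qed.

(** Taking the union of all open sets whose trace on [X_eta] lies in the image reduces the claim to
    one neighbourhood of each image point. *)
Lemma fibre_chart_open (A : set 'rV[R]_4) : open A -> A `<=` fibre_dom ->
  exists2 N : set (Defs.total R), open N & fibre_chart @` A = Xeta L eta `&` N.
Proof.
move=> oA AD.
exists (\bigcup_(N in [set N : set (Defs.total R) | open N /\
    Xeta L eta `&` N `<=` fibre_chart @` A]) N).
  by apply: bigcup_open => N [].
apply/seteqP; split=> [q [z Az <-]|q [Xq [N [_ +] Nq]]]; last by apply.
have [Uz dz] := AD _ Az.
split; first exact: (@Xeta_lift_mem _ L eta U f chart _ _ _ z Uz).
pose u := z *m base_mx.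
have [M [r [oM Mp sr rU fr]]] := local_retraction param Uz.
have ru : r (f u) = u := retraction_paramK param Uz rU fr Mp.
pose r1 (q : Defs.total R) := r q.1.
pose y (q : Defs.total R) := q.2 - eta (f (r1 q)).
(* An extension of the inverse chart to an ambient open set, made from a retraction to [L] and
   Cramer's rule in the fibre; the neighbourhood sought is the preimage of [A]. *)
pose kappa (q : Defs.total R) : 'rV[R]_4 := fibre_lift (r1 q) (y q).
pose D0 := [set q : Defs.total R | M q.1].
have oD0 : open D0.
  rewrite -[D0]setTI; apply: open_preimage oM => [|p' _]; first exact: openT.
  by apply: (smooth_on_continuous (@smooth_fst _ _ setT)).
have sr1 : smooth_on D0 r1.
  move=> k; exact: (diff_upto_comp_row oD0 oM _ (@smooth_fst _ _ D0 k) (sr k)).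
pose D := D0 `&` r1 @^-1` [set v | U v /\ fibre_det v != 0].
have oD : open D.
  apply: open_preimage => // [p'|]; first exact: (smooth_on_continuous sr1).
  exact: open_fibre_base.
have DU x : D x -> U (r1 x) by case=> _ [].
have Ddet x : D x -> fibre_det (r1 x) != 0 by case=> _ [].
have skappa : smooth_on D kappa.
  move=> k; have dr1 : diff_upto k D r1.
    by apply: sub_diff_upto (sr1 k) => x [].
  have dy : diff_upto k D y.
    have d1 := diff_upto_comp_row oD (chart_open chart) DU dr1
      (smooth_eta_chart heta chart k).
    have := diff_uptoD oD (@smooth_snd _ _ D k)
      (diff_upto_scale oD (diff_upto_cst k D (-1 : R^o)) d1).
    by apply: eq_diff_upto => // x _; rewrite /cst scaleN1r.
  have ddet := diff_uptoV oD Ddet (diff_upto_comp oD DU dr1 (smooth_fibre_det k)).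
  have dq b := diff_uptoM oD (diff_upto_dot oD dy (diff_upto_cst k D b)) ddet.
  apply/diff_upto_rowP => //; apply: forall4P.
  - apply: (eq_diff_upto oD _ ((diff_upto_rowP k r1 oD).1 dr1 0)) => x _.
    by rewrite /kappa /fibre_lift row4E.
  - apply: (eq_diff_upto oD _ ((diff_upto_rowP k r1 oD).1 dr1 1)) => x _.
    by rewrite /kappa /fibre_lift row4E.
  - by apply: (eq_diff_upto oD _ (dq b2)) => x _; rewrite /kappa /fibre_lift row4E.
  - apply: (eq_diff_upto oD _ (diff_uptoM oD (diff_upto_cst k D (-1 : R^o)) (dq b1))).
    by move=> x _; rewrite /kappa /fibre_lift row4E /cst mulN1r.
exists (D `&` kappa @^-1` A).
  split.
    by apply: open_preimage => // p'; exact: (smooth_on_continuous skappa).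
  move=> x [[Lx [s Fs xE]] [Dx Akx]]; exists (kappa x) => //.
  have fx : f (r1 x) = x.1 by apply: fr => //; case: Dx.
  have yE : y x = s by rewrite /y fx xE addrAC subrr add0r.
  have sW : dot s (chart_asd f (r1 x)) = 0.
    by apply/(chart_FplaneP chart _ (DU _ Dx)); rewrite fx.
  have -> : kappa x = fibre_lift (r1 x) s by rewrite /kappa yE.
  rewrite (fibre_liftK (Ddet x Dx) sW).
  by rewrite fx -xE -surjective_pairing.
have r1z : r1 (fibre_chart z) = u by rewrite /r1 /= ru.
have yz : y (fibre_chart z) = cross (chart_asd f u) (z *m fibre_mx).
  by rewrite /y r1z /= addrAC subrr add0r.
have Dz : D (fibre_chart z).
  by split; [exact: Mp|rewrite /preimage /= r1z; split].
have kz : kappa (fibre_chart z) = z.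
  apply: fibre_mx_eq; first by rewrite /kappa fibre_lift_base r1z.
    by rewrite /kappa /fibre_lift row4E yz r1z fibre_mxE dot_fibrer mulfK.
  by rewrite /kappa /fibre_lift row4E yz r1z fibre_mxE dot_fibrel mulNr opprK mulfK.
by split; [exact: Dz|rewrite /preimage /= kz].
Qed.

Lemma fibre_local_param : local_param (Xeta L eta) fibre_dom fibre_chart.
Proof.
split.
- exact: open_fibre_dom.
- exact: smooth_fibre_chart.
- exact: fibre_chart_inj.
- exact: fibre_chart_immersion.
- exact: fibre_chart_open.
Qed.

End Submanifold.

(** * Coassociativity as an equation in charts *)

Section Coassociative.
Context {R : realType} (L : oriented_surface R) (eta : 'rV[R]_4 -> 'rV[R]_3).
Hypothesis heta : smooth_section_E L eta.

Lemma Xeta_submanifold : submanifold 'rV[R]_4 (Xeta L eta).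
Proof.
move=> p [Lp [s Fs pE]].
have [U [f [chart [u Uu fu]]]] := os_cover Lp.
have [b1 wb1] := cross_neq0 (chart_asd_neq0 chart Uu).
(* This makes [fibre_det] at [u] the squared norm of [cross (chart_asd f u) b1]. *)
pose b2 := cross (chart_asd f u) b1.
exists (fibre_dom U f b1 b2), (fibre_chart eta f b1 b2).
split; first exact: fibre_local_param.
have du : fibre_det f b1 b2 u != 0 by rewrite /fibre_det dot_eq0.
exists (fibre_lift f b1 b2 u s); first by rewrite /fibre_dom /= fibre_lift_base.
rewrite fibre_liftK // ?fu -?pE -?surjective_pairing //.
by apply/(chart_FplaneP chart _ Uu); rewrite fu.
Qed.

(** For the converse, vertical parts are orthogonal to [w]: they are coplanar, so their triple
    product is 0, and each remaining term of [phi] pairs one of them with a multiple of [w]. *)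
Lemma coassociative_chartP : coassociative (Xeta L eta) <->
  (forall U f u a b, os_charts L U f -> U u ->
     dot ('D_a (eta \o f) u + cross ('D_a (chart_asd f) u) b) (chart_asd f u) = 0).
Proof.
split=> [H U f u a b chart Uu|H]; first exact: (coassociative_chart heta chart H).
split; first exact: Xeta_submanifold.
move=> p [Lp _] x y z Tx Ty Tz.
have [U [f [chart [u Uu fu]]]] := os_cover Lp.
have inv v := Xeta_tangent_inv heta chart
  (fun u a b => H U f u a b chart) (v := v) Uu (esym fu).
have [[a [xE xw]] [b [yE yw]] [c [zE zw]]] := And3 (inv _ Tx) (inv _ Ty) (inv _ Tz).
have df := chart_differentiable chart Uu.
rewrite phiE xE yE zE (asd_derive _ _ df) (asd_derive _ _ df) (asd_derive _ _ df).
rewrite !dotZr xw yw zw !mulr0 !addr0.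
exact: (dot_cross_eq0 (chart_asd_neq0 chart Uu)).
Qed.

End Coassociative.

Theorem theorem3p3 (R : realType) (L : oriented_surface R)
    (eta : 'rV[R]_4 -> 'rV[R]_3) (heta : smooth_section_E L eta) :
  coassociative (Xeta L eta) <-> negative_superminimal L /\ parallelE L eta.
Proof.
rewrite (propext (coassociative_chartP heta)) (propext (superminimal_chartP L)).
rewrite (propext (parallel_chartP heta)); split=> [H|[H1 H2] U f u a b chart Uu].
  have H2 U f u a : os_charts L U f -> U u ->
      dot ('D_a (eta \o f) u) (chart_asd f u) = 0.
    by move=> chart Uu; have := H U f u a 0 chart Uu; rewrite cross0r addr0.
  split=> // U f u a chart Uu b.
  by have := H U f u a b chart Uu; rewrite dotDl (H2 _ _ _ _ chart Uu) add0r.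
by rewrite dotDl (H2 _ _ _ _ chart Uu) (H1 _ _ _ _ chart Uu) addr0.
Qed.
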